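(* Let $(F,G)\in\mathbb{C}[x,y]^2$ be a Jacobian pair whose Keller map $\sigma$ is not injective, let $V=\{(p_1,p_2)=((x_1,y_1),(x_2,y_2))\in\mathbb{C}^2\times\mathbb{C}^2 : \sigma(p_1)=\sigma(p_2),\ p_1\ne p_2\}$, and assume that $|y_1|+|y_2|=o(h_{p_1,p_2})$ when $h_{p_1,p_2}\to\infty$ for $(p_1,p_2)\in V$, where $h_{p_1,p_2}=|x_1|+|y_1|+|x_2|+|y_2|$. Then the projection $\pi_1:V\to\mathbb{C}^2$, $\pi_1(p_1,p_2)=(x_1,x_2)$ for $(p_1,p_2)=((x_1,y_1),(x_2,y_2))\in V$, is proper, finite and surjective.
   Context: A Jacobian pair is a pair $(F,G)\in\mathbb{C}[x,y]^2$ with $J(F,G)=\frac{\partial F}{\partial x}\frac{\partial G}{\partial y}-\frac{\partial F}{\partial y}\frac{\partial G}{\partial x}\in\mathbb{C}\setminus\{0\}$; its Keller map is $\sigma:\mathbb{C}^2\to\mathbb{C}^2$, $p\mapsto(F(p),G(p))$. The condition $|y_1|+|y_2|=o(h_{p_1,p_2})$ means: for every $\varepsilon>0$ there is $R>0$ such that $|y_1|+|y_2|\le\varepsilon h_{p_1,p_2}$ for all $(p_1,p_2)\in V$ with $h_{p_1,p_2}\ge R$. The set $V$ is a closed algebraic subvariety of $\mathbb{C}^4$. *)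

(* Defs.v *)
From HB Require Import structures.
From mathcomp Require Import all_boot all_order all_algebra.
From mathcomp Require Export complex mpoly.
From mathcomp Require Export classical_sets functions reals topology normedtype.
Set Implicit Arguments.
Unset Strict Implicit.
Unset Printing Implicit Defensive.
Import Order.TTheory GRing.Theory Num.Theory.
Import numFieldNormedType.Exports.
Local Open Scope classical_set_scope.
Local Open Scope ring_scope.

(* Everything is written over an arbitrary [C : numClosedFieldType], whose     *)
(* canonical topology is the one of its norm, and is meant to be used at       *)
(* [C := R[i]] with [R : realType].                                            *)

Definition eval2 (C : numClosedFieldType) (F : {mpoly C[2]}) (p : C * C) : C :=
  F.@[tnth [tuple p.1; p.2]].

(* The coordinates of C^4 = C^2 * C^2 are taken in the order x1, y1, x2, y2.   *)
Definition eval4 (C : numClosedFieldType) (g : {mpoly C[4]})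
    (p : (C * C) * (C * C)) : C :=
  g.@[tnth [tuple p.1.1; p.1.2; p.2.1; p.2.2]].

Definition jacobian (C : numClosedFieldType) (F G : {mpoly C[2]}) :
    {mpoly C[2]} :=
  F^`M(ord0) * G^`M(ord_max) - F^`M(ord_max) * G^`M(ord0).

Definition jacobian_pair (C : numClosedFieldType) (F G : {mpoly C[2]}) : Prop :=
  exists2 c : C, c != 0 & jacobian F G = c%:MP.

Definition keller_map (C : numClosedFieldType) (F G : {mpoly C[2]})
    (p : C * C) : C * C :=
  (eval2 F p, eval2 G p).

Definition noninj_locus (C : numClosedFieldType) (F G : {mpoly C[2]}) :
    set ((C * C) * (C * C)) :=
  [set p | keller_map F G p.1 = keller_map F G p.2 /\ p.1 <> p.2].

Definition height (C : numClosedFieldType) (p : (C * C) * (C * C)) : C :=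
  `|p.1.1| + `|p.1.2| + `|p.2.1| + `|p.2.2|.

(* The order of C is partial: [0 < z] entails that z is real, so [eps] and     *)
(* [rho] range over the positive reals, and norms are real elements of C.      *)
Definition y_little_o_height (C : numClosedFieldType)
    (Z : set ((C * C) * (C * C))) : Prop :=
  forall eps : C, 0 < eps ->
  exists2 rho : C, 0 < rho &
    forall p, Z p -> rho <= height p ->
      `|p.1.2| + `|p.2.2| <= eps * height p.

(* It projects on the two x-coordinates, not on the first point.               *)
Definition pi1 (C : numClosedFieldType) (p : (C * C) * (C * C)) : C * C :=
  (p.1.1, p.2.1).

(* A subset of T contained in Z is compact for the subspace topology of Z      *)
(* if and only if it is compact in T.                                          *)
Definition proper_on (T U : topologicalType) (Z : set T) (f : T -> U) : Prop :=
  {within Z, continuous f} /\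
  forall K : set U, compact K -> compact (Z `&` f @^-1` K).

Definition zariski_closed (C : numClosedFieldType)
    (Z : set ((C * C) * (C * C))) : Prop :=
  exists S : set {mpoly C[4]},
    Z = [set p | forall g, S g -> eval4 g p = 0].

Definition vanishing_ideal (C : numClosedFieldType)
    (Z : set ((C * C) * (C * C))) : set {mpoly C[4]} :=
  [set g | forall p, Z p -> eval4 g p = 0].

(* Finiteness of a morphism f = (u, v) from the affine variety Z to C^2: the   *)
(* coordinate ring C[x1,y1,x2,y2] / I(Z) is generated by the classes of        *)
(* finitely many polynomials m_i as a module over C[X,Y], which acts through   *)
(* the pullback a |-> a(u, v).                                                 *)
Definition finite_morphism (C : numClosedFieldType)
    (Z : set ((C * C) * (C * C))) (f : (C * C) * (C * C) -> C * C) : Prop :=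
  zariski_closed Z /\
  exists u v : {mpoly C[4]},
    (forall p, Z p -> f p = (eval4 u p, eval4 v p)) /\
    exists (k : nat) (m : 'I_k -> {mpoly C[4]}),
    forall g : {mpoly C[4]}, exists a : 'I_k -> {mpoly C[2]},
      vanishing_ideal Z (g - \sum_(i < k) (a i \mPo [tuple u; v]) * m i).

(* Main.v *)
Require Import Defs.
From HB Require Import structures.
From mathcomp Require Import all_boot all_order all_algebra.
From mathcomp Require Import complex mpoly.
From mathcomp Require Import boolp classical_sets functions reals topology normedtype.
From mathcomp Require Import ring.
Import Order.TTheory GRing.Theory Num.Theory.
Import numFieldNormedType.Exports.
Local Open Scope classical_set_scope.
Local Open Scope ring_scope.

Set Implicit Arguments.
Unset Strict Implicit.
Unset Printing Implicit Defensive.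

(** Write V for the non-injectivity locus, f = F(x1,y1) - F(x2,y2),
    g = G(x1,y1) - G(x2,y2), and sigma for the Keller map.

    Growth.  Taking epsilon = 1/2 in the hypothesis gives a constant rho with
    |y1| + |y2| <= rho + |x1| + |x2| on V ([linear_growth_of_little_o]).  Also V
    is closed, because it is the zero set of f, g and one more polynomial
    ([noninj_locus_equations]): f and g are linear combinations of x1 - x2 and
    y1 - y2, the determinant of the coefficients vanishes where f = g = 0 off
    the diagonal, and on the diagonal it is the Jacobian of (F,G).  So the part
    of V over a compact set is closed and bounded, and pi1 is proper.

    An integral equation for y1.  Suppose that F and G both have positive
    degree in y; this can be arranged by replacing one of them by F + G, which
    leaves V alone.  Let P(x1,x2,T) be the resultant with respect to Y of
    F(x1,T) - F(x2,Y) and G(x1,T) - G(x2,Y).  If a <> b and the leading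
    coefficients in y of F and G do not vanish at x = b, then the roots of
    P(a,b,T) are exactly the y1-coordinates of the points of V over (a,b), so
    they are bounded by rho + |a| + |b|.  Hence each coefficient of P(a,b,T) is
    bounded by a polynomially growing multiple of the leading one.  A quotient
    of univariate polynomials that is locally bounded is a polynomial, and this
    forces P = c(x2) (x1 - x2)^k M with M monic in T
    ([bounded_roots_monic_factor]).

    M vanishes on V.  The hamiltonian derivations of F and G, acting on both
    points at once, kill f and g up to constants that cancel, so they are
    tangent to V.  For v in V, the polynomials all of whose iterated derivatives
    along them vanish at v form a prime ideal ([flat_prime]): it is the ideal of
    the germ of V at v, without the germ being built.  It contains f and g, so
    it contains P(x1,x2,y1).  It contains no nonzero polynomial in x2, because
    sigma is unramified at the second point, and it does not contain x1 - x2: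
    otherwise V would near v be a family of translations in y leaving F(x,.) and
    G(x,.) invariant, so that these would be constant in y
    ([not_flat_diagonal]).  By primality it contains M(x1,x2,y1), which
    therefore vanishes at v.

    Conclusion.  M is an integral equation for y1, and the exchange of the two
    points turns it into one for y2, so the monomials y1^i y2^j with
    i, j < deg M generate the coordinate ring ([finite_of_relations]).  As V is
    not empty, M is not 1; so for generic (a,b) M(a,b,T) has a root, which lifts
    to V.  The image of pi1 is thus dense, and it is closed by properness. *)

(** * Polynomials whose specializations have bounded roots *)

Lemma nonroot_near (C : numFieldType) (s : {poly C}) (t0 d : C) :
  s != 0 -> 0 < d -> exists2 e : C, 0 < e < d & s.[t0 + e] != 0.
Proof.
move=> s0 d0; pose x (i : nat) : C := t0 + d / i.+2%:R.
have xinj : injective x.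
  move=> i j /addrI /(mulfI (lt0r_neq0 d0)) /invr_inj /eqP.
  by rewrite eqr_nat => /eqP [].
case: (boolP (all (root s) (map x (iota 0 (size s))))) => [allr|].
  have u : uniq (map x (iota 0 (size s))) by rewrite map_inj_uniq ?iota_uniq.
  by have := max_poly_roots s0 allr u; rewrite size_map size_iota ltnn.
case/allPn=> _ /mapP[i _ ->] nr; exists (d / i.+2%:R) => //.
by rewrite divr_gt0 //= ltr_pdivrMr // ltr_pMr // ltr1n.
Qed.

Lemma poly_eq0_off (C : numFieldType) (s p : {poly C}) :
  s != 0 -> (forall t, s.[t] != 0 -> p.[t] = 0) -> p = 0.
Proof.
move=> s0 ps; apply/eqP; apply: contraT => p0.
have sp0 : s * p != 0 by rewrite mulf_neq0.
have [e _] := nonroot_near 0 sp0 ltr01.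
rewrite hornerM mulf_eq0 negb_or => /andP[s1 /negP[]].
by rewrite ps.
Qed.

(** The inequality passes to the limit t -> t0, where its right-hand side
    vanishes; the exceptional roots of [s] do not accumulate at t0. *)
Lemma root_of_norm_le (C : numFieldType) (s p q : {poly C}) (t0 B : C) :
  s != 0 -> root q t0 -> 0 <= B ->
  (forall t : C, `|t - t0| <= 1 -> s.[t] != 0 -> `|p.[t]| <= B * `|q.[t]|) ->
  root p t0.
Proof.
move=> s0 /factor_theorem[q1 ->] B0 le_pq; apply: contraT => pt0.
have pt0_gt0 : 0 < `|p.[t0]| by rewrite normr_gt0.
have /factor_theorem[p1 pE] : root (p - p.[t0]%:P) t0.
  by rewrite /root !hornerE subrr.
have [B1 B1P] := poly_disk_bound p1 (`|t0| + 1).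
have [B2 B2P] := poly_disk_bound q1 (`|t0| + 1).
have t0b : `|t0| <= `|t0| + 1 by rewrite lerDl.
have B10 : 0 <= B1 := le_trans (normr_ge0 _) (B1P _ t0b).
have B20 : 0 <= B2 := le_trans (normr_ge0 _) (B2P _ t0b).
pose L := `|p.[t0]| + (B1 + B * B2).
have L0 : 0 < L by rewrite ltr_pwDl // addr_ge0 ?mulr_ge0.
(* With e < |p(t0)| / L the bound at t0 + e would give |p(t0)| <= e L. *)
have [e /andP[e0]] := nonroot_near t0 s0 (divr_gt0 pt0_gt0 L0).
rewrite ltr_pdivlMr // => eL se.
have e1 : e <= 1.
  rewrite -(ler_pM2r L0) mul1r; apply: le_trans (ltW eL) _.
  by rewrite lerDl addr_ge0 ?mulr_ge0.
have te : t0 + e - t0 = e by rewrite addrAC subrr add0r.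
have nt : `|t0 + e| <= `|t0| + 1.
  by apply: le_trans (ler_normD _ _) _; rewrite lerD2l gtr0_norm.
have := le_pq (t0 + e); rewrite !hornerE te normrM (gtr0_norm e0).
move=> /(_ e1 se).
have -> : p.[t0 + e] = p.[t0] + p1.[t0 + e] * e.
  have := congr1 (horner^~ (t0 + e)) pE; rewrite /= !hornerE te => /eqP.
  by rewrite subr_eq => /eqP ->; rewrite addrC.
move=> le1; suff: `|p.[t0]| <= e * L by rewrite (lt_geF eL).
have -> : `|p.[t0]| = `|(p.[t0] + p1.[t0 + e] * e) - p1.[t0 + e] * e|.
  by rewrite addrK.
apply: le_trans (ler_normB _ _) _; rewrite normrM (gtr0_norm e0).
rewrite /L mulrDr; apply: ler_wpDl; first by rewrite mulr_ge0 // ltW.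
rewrite mulrDr addrC; apply: lerD; first by rewrite mulrC ler_pM2l // B1P.
by apply: le_trans le1 _; rewrite [e * _]mulrC mulrA ler_pM2r // ler_wpM2l // B2P.
Qed.

(** A locally bounded quotient of polynomials has no pole: each root of [q] is a
    root of [p], and dividing both by the corresponding linear factor preserves
    the bound away from that root. *)
Lemma dvdp_of_norm_le (C : numClosedFieldType) (s p q : {poly C}) :
  s != 0 -> q != 0 ->
  (forall t0 : C, exists2 B : C, 0 <= B & forall t : C, `|t - t0| <= 1 -> s.[t] != 0 ->
     `|p.[t]| <= B * `|q.[t]|) ->
  q %| p.
Proof.
move: {2}(size q) (leqnn (size q)) => n.
elim: n s p q => [|n IHn] s p q; first by rewrite leqn0 size_poly_eq0 => ->.
move=> sq s0 q0 pq.
have [q1|/closed_rootP[t0 qt0]] := eqVneq (size q) 1.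
  by rewrite dvdUp // -size_poly_eq1 q1.
have [B B0 BP] := pq t0.
have /factor_theorem[p1 pE] := root_of_norm_le s0 qt0 B0 BP.
case/factor_theorem: qt0 => q1 qE; rewrite pE qE dvdp_mul2r ?polyXsubC_eq0 //.
have q10 : q1 != 0 by apply: contraNneq q0 => q10; rewrite qE q10 mul0r.
apply: (IHn (s * ('X - t0%:P))) => //.
- by rewrite -ltnS (leq_trans _ sq) // qE size_mul ?polyXsubC_eq0 // size_XsubC addn2.
- by rewrite mulf_neq0 // polyXsubC_eq0.
move=> t1; have [B' B'0 B'P] := pq t1; exists B' => // t tt1.
rewrite !hornerE mulf_eq0 negb_or => /andP[st tt0].
have := B'P t tt1 st; rewrite pE qE !hornerE !normrM mulrA ler_pM2r //.
by rewrite normr_gt0.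
Qed.

(** Multiplication by X - z multiplies a bound on the coefficients by at most
    1 + |z|. *)
Lemma coef_prod_XsubC_le (C : numFieldType) (rs : seq C) (b : C) (j : nat) :
  0 <= b -> {in rs, forall z, `|z| <= b} ->
  `|(\prod_(z <- rs) ('X - z%:P))`_j| <= (1 + b) ^+ size rs.
Proof.
move=> b0; elim: rs j => [|z rs IH] j rsb.
  by rewrite big_nil coef1 normr_nat lern1 leq_b1.
have IH' k : `|(\prod_(z <- rs) ('X - z%:P))`_k| <= (1 + b) ^+ size rs.
  by apply: IH => z' h; rewrite rsb // inE h orbT.
rewrite big_cons mulrBl coefB coefXM mul_polyC coefZ /= exprS mulrDl mul1r.
apply: le_trans (ler_normB _ _) _; apply: lerD.
  by case: ifP => _ //; rewrite normr0 exprn_ge0 // addr_ge0.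
by rewrite normrM ler_pM // rsb ?mem_head.
Qed.

Lemma coef_le_lead_coef (C : numClosedFieldType) (p : {poly C}) (b : C)
    (j : nat) :
  0 <= b -> (forall z, root p z -> `|z| <= b) ->
  `|p`_j| <= (1 + b) ^+ (size p).-1 * `|lead_coef p|.
Proof.
move=> b0 pb; have [->|p0] := eqVneq p 0.
  by rewrite coef0 lead_coef0 normr0 mulr0.
have lp0 : lead_coef p != 0 by rewrite lead_coef_eq0.
have [rs pE] := closed_field_poly_normal p.
have sp : (size p).-1 = size rs.
  by rewrite {1}pE size_scale // size_prod_XsubC.
rewrite {1}pE coefZ normrM mulrC ler_pM2r ?normr_gt0 // sp.
apply: coef_prod_XsubC_le => // z zrs; apply: pb.
by rewrite pE rootZ // root_prod_XsubC.
Qed.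

(** The extension of a ring morphism [f] to polynomials that sends the variable
    to [x].  Iterated, it evaluates nested polynomial rings, and each identity
    is proved once for points and for generic coordinates. *)
HB.lock Definition subst (R : nzRingType) (A : comNzRingType)
    (f : {rmorphism R -> A}) (x : A) (p : {poly R}) : A := (map_poly f p).[x].

Lemma substE (R : nzRingType) (A : comNzRingType) (f : {rmorphism R -> A})
    (x : A) p : subst f x p = (map_poly f p).[x].
Proof. by rewrite unlock. Qed.

Fact subst_is_zmod_morphism (R : nzRingType) (A : comNzRingType)
    (f : {rmorphism R -> A}) (x : A) : zmod_morphism (subst f x).
Proof. by move=> p q; rewrite !substE rmorphB hornerD hornerN. Qed.

Fact subst_is_monoid_morphism (R : nzRingType) (A : comNzRingType)
    (f : {rmorphism R -> A}) (x : A) : monoid_morphism (subst f x).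
Proof.
by split=> [|p q]; rewrite !substE ?rmorph1 ?hornerC // rmorphM hornerM.
Qed.

HB.instance Definition _ (R : nzRingType) (A : comNzRingType)
    (f : {rmorphism R -> A}) (x : A) :=
  GRing.isZmodMorphism.Build {poly R} A (subst f x)
    (subst_is_zmod_morphism f x).
HB.instance Definition _ (R : nzRingType) (A : comNzRingType)
    (f : {rmorphism R -> A}) (x : A) :=
  GRing.isMonoidMorphism.Build {poly R} A (subst f x)
    (subst_is_monoid_morphism f x).

Lemma substC (R : nzRingType) (A : comNzRingType) (f : {rmorphism R -> A})
    (x : A) c : subst f x c%:P = f c.
Proof. by rewrite substE map_polyC hornerC. Qed.

Lemma substX (R : nzRingType) (A : comNzRingType) (f : {rmorphism R -> A})
    (x : A) : subst f x 'X = x.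
Proof. by rewrite substE map_polyX hornerX. Qed.

Notation eval_at a b := (subst (horner_eval b) a).

Lemma eval_at_swap (C : comNzRingType) (a b : C) (p : {poly {poly C}}) :
  eval_at a b p = p.[a%:P].[b].
Proof.
rewrite substE.
have {1}-> : a = horner_eval b a%:P by rewrite /horner_eval hornerC.
by rewrite horner_map.
Qed.

(** Since the leading coefficient of [q] is a constant, Euclidean division by
    [q] commutes with specialization of the inner variable, so the remainder has
    zero specialization everywhere. *)
Lemma dvd_of_fiberwise (C : numFieldType) (p q : {poly {poly C}}) (u : C) :
  u != 0 -> lead_coef q = u%:P ->
  (forall a, map_poly (horner_eval a) q %| map_poly (horner_eval a) p) ->
  exists m, p = q * m.
Proof.
move=> u0 qu qp; pose q1 := (u^-1)%:P%:P * q.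
have q1m : q1 \is monic.
  by rewrite monicE lead_coefM lead_coefC qu -polyCM mulVf.
have pE := Pdiv.RingMonic.rdivp_eq q1m p; set r := Pdiv.Ring.rmodp _ _ in pE.
have sr : (size r < size q1)%N by rewrite Pdiv.Ring.ltn_rmodpN0 ?monic_neq0.
have r0 : r = 0.
  apply/polyP => i; rewrite coef0; apply: (poly_eq0_off (oner_neq0 _)) => a _.
  have q1am : map_poly (horner_eval a) q1 \is monic by rewrite monic_map.
  suff : map_poly (horner_eval a) r = 0.
    by move/(congr1 (fun s : {poly C} => s`_i)); rewrite coef0 coef_map.
  apply/eqP; apply: contraTT (qp a) => ra0.
  rewrite [in X in ~~ (_ %| X)]pE rmorphD rmorphM /=.
  have -> : map_poly (horner_eval a) q = u%:P * map_poly (horner_eval a) q1.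
    rewrite rmorphM /= map_polyC /= /horner_eval hornerC mulrA -polyCM.
    by rewrite mulfV // mul1r.
  rewrite mul_polyC dvdpZl // dvdp_addr ?dvdp_mull //.
  apply: contraNN ra0 => /dvdp_leq.
  case: eqVneq => // ra0 /(_ isT); rewrite leqNgt => /negP[].
  apply: leq_ltn_trans (size_poly _ _) _; apply: leq_trans sr _.
  by rewrite -(size_map_poly_id0 (f := horner_eval a)) // (eqP q1m) rmorph1 oner_neq0.
exists ((u^-1)%:P%:P * Pdiv.Ring.rdivp p q1).
by rewrite {1}pE r0 addr0 /q1 mulrCA mulrA mulrC.
Qed.

Lemma poly_dvd_coef (R : comNzRingType) (q : R) (P : {poly R}) :
  (forall j, exists m, P`_j = q * m) -> exists M, P = q%:P * M.
Proof.
elim/poly_ind: P => [|P c IH] qP; first by exists 0; rewrite mulr0.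
have [|M ->] := IH.
  by move=> j; have [m] := qP j.+1; rewrite coefD coefMX coefC /= addr0; exists m.
have [m] := qP 0%N; rewrite coefD coefMX coefC /= add0r => ->.
by exists (M * 'X + m%:P); rewrite mulrDr mulrA -polyCM.
Qed.

Lemma le1D_exp (C : numDomainType) (x y : C) n :
  0 <= x -> x <= y -> (1 + x) ^+ n <= (1 + y) ^+ n.
Proof.
move=> x0 xy; have y0 := le_trans x0 xy.
by rewrite lerXn2r ?nnegrE ?addr_ge0 // lerD2l.
Qed.

Lemma norm_le_near (C : numDomainType) (x y : C) :
  `|x - y| <= 1 -> `|x| <= `|y| + 1.
Proof. by move=> xy; rewrite -lerBlDl (le_trans (lerB_dist _ _)). Qed.

(** In this section the inner variable of {poly {poly C}} is b and the outer one
    is a; polynomials in a third variable T have these as coefficients. *)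
Section BoundedRoots.
Variables (C : numClosedFieldType) (P : {poly {poly {poly C}}}).
Variables (c0 : {poly C}) (rho : C).
Hypotheses (c0_neq0 : c0 != 0) (rho0 : 0 <= rho).
Hypothesis root_le : forall a b t : C, a != b -> c0.[b] != 0 ->
  root (map_poly (eval_at a b) P) t -> `|t| <= rho + `|a| + `|b|.

Let q := lead_coef P.
Let c := lead_coef q.

Let bound_ge0 (a b : C) : 0 <= rho + `|a| + `|b|.
Proof. by rewrite !addr_ge0. Qed.

(** The zero polynomial has arbitrarily large roots. *)
Lemma specialization_neq0 (a b : C) :
  a != b -> c0.[b] != 0 -> map_poly (eval_at a b) P != 0.
Proof.
move=> ab c0b; apply/eqP => Pab0.
have := root_le (t := rho + `|a| + `|b| + 1) ab c0b.
rewrite Pab0 root0 => /(_ isT); rewrite ger0_norm ?addr_ge0 //.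
by rewrite gerDl ler10.
Qed.

Let P0 : P != 0.
Proof.
have [e _] := nonroot_near 0 c0_neq0 ltr01; rewrite add0r => c0e.
have ee1 : e + 1 != e by rewrite -subr_eq0 addrAC subrr add0r oner_neq0.
apply: contraNneq (specialization_neq0 ee1 c0e) => ->.
by rewrite rmorph0.
Qed.

Let q_neq0 : q != 0. Proof. by rewrite lead_coef_eq0. Qed.
Let c_neq0 : c != 0. Proof. by rewrite lead_coef_eq0. Qed.

Lemma specialized_coef_le (a b : C) j :
  a != b -> c0.[b] != 0 -> eval_at a b q != 0 ->
  `|eval_at a b P`_j| <=
  (1 + (rho + `|a| + `|b|)) ^+ (size P).-1 * `|eval_at a b q|.
Proof.
move=> ab c0b qab; have := coef_le_lead_coef j (bound_ge0 a b)
  (fun t => root_le (t := t) ab c0b).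
rewrite coef_map size_map_poly_id0 // lead_coef_map_eq //.
Qed.

(** For fixed b, the coefficient bound makes the leading coefficient q(.,b)
    divide every coefficient of P.  So P would vanish identically at a root
    a <> b of q(.,b), which is excluded: b is the only root. *)
Lemma lead_coef_fiber (b : C) : (c0 * c).[b] != 0 ->
  (forall j, map_poly (horner_eval b) q %| map_poly (horner_eval b) P`_j) /\
  map_poly (horner_eval b) q = c.[b]%:P * ('X - b%:P) ^+ (size q).-1.
Proof.
rewrite hornerM mulf_eq0 negb_or => /andP[c0b cb].
set qb := map_poly (horner_eval b) q.
have lqb : lead_coef qb = c.[b] by rewrite lead_coef_map_eq.
have qb0 : qb != 0 by rewrite -lead_coef_eq0 lqb.
have qP j : qb %| map_poly (horner_eval b) P`_j.
  apply: (dvdp_of_norm_le (s := ('X - b%:P) * qb)) => //.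
    by rewrite mulf_neq0 // polyXsubC_eq0.
  move=> t0; exists ((1 + (rho + (`|t0| + 1) + `|b|)) ^+ (size P).-1 : C).
    by rewrite exprn_ge0 // !addr_ge0.
  move=> a at0 sa.
  rewrite !hornerE mulf_eq0 negb_or subr_eq0 in sa; case/andP: sa => ab qa.
  rewrite -!substE; apply: le_trans (specialized_coef_le _ ab c0b _) _.
    by rewrite substE.
  apply: ler_wpM2r => //; apply: le1D_exp; first exact: bound_ge0.
  by apply: lerD => //; apply: lerD => //; apply: norm_le_near.
split=> //; have [rs qbE] := closed_field_poly_normal qb.
have srs : size rs = (size q).-1.
  rewrite -[size q](size_map_poly_id0 (f := horner_eval b)) //.
  by rewrite -/qb [in RHS]qbE size_scale ?lqb // size_prod_XsubC.
rewrite [LHS]qbE lqb -mul_polyC -srs; congr (_ * _).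
have rsb : all (pred1 b) rs.
  apply/allP => a ars; rewrite /=; apply: contraT => ab.
  have qa0 : qb.[a] = 0.
    by apply/rootP; rewrite qbE rootZ ?lqb // root_prod_XsubC.
  case/eqP: (specialization_neq0 ab c0b); apply/polyP => j.
  rewrite coef_map coef0 /= substE; apply/rootP.
  by apply: root_dvdp (qP j) _; apply/rootP.
by rewrite (all_pred1P _ _ rsb) big_nseq iter_mulr_1 size_nseq.
Qed.

Lemma lead_coef_factor : q = c%:P * ('X - 'X%:P) ^+ (size q).-1.
Proof.
apply/eqP; rewrite -subr_eq0; apply/eqP/polyP => i; rewrite coef0.
have s0 : c0 * c != 0 by rewrite mulf_neq0.
apply: (poly_eq0_off s0) => b cb; have [_ qbE] := lead_coef_fiber cb.
set d := q - _; suff : map_poly (horner_eval b) d = 0.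
  by move/(congr1 (fun s : {poly C} => s`_i)); rewrite coef0 coef_map.
rewrite /d rmorphB rmorphM rmorphXn rmorphB /= qbE map_polyX !map_polyC /=.
by rewrite /horner_eval hornerX subrr.
Qed.

(** By [lead_coef_factor] the leading coefficient is, seen as a polynomial in b,
    monic up to a nonzero constant.  The coefficient bound, now used for fixed
    a, makes it divide each coefficient of P fiberwise, hence globally by
    [dvd_of_fiberwise]. *)
Theorem bounded_roots_monic_factor :
  exists (d : {poly C}) (k : nat) (M : {poly {poly {poly C}}}),
  [/\ d != 0, M \is monic & P = (d%:P * ('X - 'X%:P) ^+ k)%:P * M].
Proof.
exists c, (size q).-1.
rewrite -lead_coef_factor; have qswap : lead_coef (swapXY q) =
    (lead_coef c * (-1) ^+ (size q).-1)%:P.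
  rewrite lead_coef_factor rmorphM rmorphXn rmorphB /= !swapXY_polyC map_polyX.
  rewrite swapXY_X lead_coefM lead_coef_exp lead_coef_map_id0 ?polyC0 //; last first.
    by rewrite polyC_eq0 lead_coef_eq0.
  (* The sign comes from reading a - b as a polynomial in b. *)
  rewrite -opprB lead_coefN lead_coefXsubC -lead_coef_factor.
  by rewrite polyCM rmorphXn rmorphN.
have dvd j : exists m, P`_j = q * m.
  have u0 : lead_coef c * (-1) ^+ (size q).-1 != 0.
    by rewrite mulf_neq0 ?lead_coef_eq0 // signr_eq0.
  have [|m mE] := dvd_of_fiberwise (p := swapXY P`_j) u0 qswap.
    move=> a; rewrite -!horner_swapXY !swapXYK.
    have qa0 : q.[a%:P] != 0.
      rewrite lead_coef_factor !hornerE mulf_neq0 //.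
      by rewrite expf_neq0 // -opprB oppr_eq0 polyXsubC_eq0.
    apply: (dvdp_of_norm_le (s := c0 * ('X - a%:P) * q.[a%:P])) => //.
      by rewrite !mulf_neq0 ?polyXsubC_eq0.
    move=> t0; exists ((1 + (rho + `|a| + (`|t0| + 1))) ^+ (size P).-1 : C).
      by rewrite exprn_ge0 // !addr_ge0.
    move=> b bt0 sb; rewrite !hornerE !mulf_eq0 !negb_or subr_eq0 in sb.
    case/andP: sb => /andP[c0b]; rewrite eq_sym => ab qab.
    rewrite -eval_at_swap in qab; rewrite -!eval_at_swap.
    apply: le_trans (specialized_coef_le _ ab c0b qab) _.
    apply: ler_wpM2r => //; apply: le1D_exp; first exact: bound_ge0.
    by apply: lerD => //; apply: norm_le_near.
  exists (swapXY m); apply: (can_inj swapXYK).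
  by rewrite rmorphM /= swapXYK.
have [M PE] := poly_dvd_coef dvd; exists M; split=> //.
have /eqP := congr1 lead_coef PE; rewrite lead_coefM lead_coefC -/q.
by rewrite -{1}[q]mulr1 (inj_eq (mulfI q_neq0)) monicE eq_sym.
Qed.

End BoundedRoots.

(** * Flat elements for a family of derivations *)

Section DifferentialGerm.
Variables (C : numFieldType) (A : comNzRingType) (I : Type).
Variables (ev : {rmorphism A -> C}) (D : I -> A -> A).
Hypothesis DD : forall i, {morph D i : x y / x + y}.
Hypothesis DM : forall i x y, D i (x * y) = D i x * y + x * D i y.

(** For derivations tangent to a smooth variety and spanning its tangent space,
    these are the functions whose germ at the point [ev] is zero: all entries of
    their Taylor series along the variety vanish. *)
Definition flat (h : A) : Prop :=
  forall w : seq I, ev (foldl (fun x i => D i x) h w) = 0.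

Lemma flat_ev h : flat h -> ev h = 0.
Proof. exact: (@^~ [::]). Qed.

Lemma flat_der i h : flat h -> flat (D i h).
Proof. by move=> Jh w; apply: (Jh (i :: w)). Qed.

Lemma flat_intro h : ev h = 0 -> (forall i, flat (D i h)) -> flat h.
Proof. by move=> h0 Dh [|i w] //; apply: Dh. Qed.

(** Flat elements form the largest set that vanishes at [ev] and is stable under
    the derivations; the algebraic properties below are instances of this
    maximality. *)
Lemma flat_max (S : A -> Prop) :
  (forall h, S h -> ev h = 0) -> (forall i h, S h -> S (D i h)) ->
  forall h, S h -> flat h.
Proof.
move=> S0 SD h Sh w; elim: w h Sh => [|i w IH] h Sh; first exact: S0.
by apply: IH; apply: SD.
Qed.

Let iter_derD w x y : foldl (fun z i => D i z) (x + y) w =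
  foldl (fun z i => D i z) x w + foldl (fun z i => D i z) y w.
Proof. by elim: w x y => //= i w IH x y; rewrite DD IH. Qed.

Lemma der_sub i x y : D i (x - y) = D i x - D i y.
Proof. by apply: (addIr (D i y)); rewrite -DD !subrK. Qed.

Lemma flat0 : flat 0.
Proof.
move=> w; suff -> : foldl (fun z i => D i z) 0 w = 0 by rewrite rmorph0.
by apply: (addIr (foldl (fun z i => D i z) 0 w)); rewrite -iter_derD !add0r.
Qed.

Lemma flatD x y : flat x -> flat y -> flat (x + y).
Proof. by move=> Jx Jy w; rewrite iter_derD rmorphD Jx Jy addr0. Qed.

Lemma flatMl x y : flat y -> flat (x * y).
Proof.
move=> Jy w; elim: w x y Jy => [|i w IH] x y Jy /=.
  by rewrite rmorphM (flat_ev Jy) mulr0.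
by rewrite DM iter_derD rmorphD !IH ?addr0 //; apply: flat_der.
Qed.

Lemma flatMr x y : flat x -> flat (x * y).
Proof. by rewrite mulrC; apply: flatMl. Qed.

Lemma flatN x : flat x -> flat (- x).
Proof. by rewrite -mulN1r; apply: flatMl. Qed.

Lemma flatB x y : flat x -> flat y -> flat (x - y).
Proof. by move=> Jx Jy; apply: flatD => //; apply: flatN. Qed.

Lemma flat_mulrn n x : flat (x *+ n.+1) -> flat x.
Proof.
move=> Jnx w; have := Jnx w; have -> : foldl (fun z i => D i z) (x *+ n.+1) w =
    foldl (fun z i => D i z) x w *+ n.+1.
  by elim: n {Jnx} => //= n IH; rewrite mulrS iter_derD IH -mulrS.
by rewrite rmorphMn => /eqP; rewrite mulrn_eq0 => /eqP.
Qed.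

(** An element not vanishing at the point is invertible on germs. *)
Lemma flat_unit u h : ev h != 0 -> flat (u * h) -> flat u.
Proof.
move=> h0 Juh.
apply: (flat_max (S := fun x => exists2 g, ev g != 0 & flat (x * g))).
- move=> x [g g0 /flat_ev]; rewrite rmorphM => /eqP.
  by rewrite mulf_eq0 (negbTE g0) orbF => /eqP.
- move=> i x [g g0 Jxg]; exists (g * g); first by rewrite rmorphM mulf_neq0.
  have -> : D i x * (g * g) = D i (x * g) * g - x * g * D i g.
    by rewrite DM; ring.
  by apply: flatB; apply: flatMr => //; apply: flat_der.
- by exists h.
Qed.

Let derX i x m : D i (x ^+ m) * x = x ^+ m * D i x *+ m.
Proof.
elim: m => [|m IH].
  have : D i 1 + 0 = D i 1 + D i 1.
    by rewrite addr0; have := DM i 1 1; rewrite !mulr1 mul1r.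
  by move/addrI => <-; rewrite mul0r.
by rewrite exprS DM mulrDl -[x * _ * x]mulrA IH mulrS; ring.
Qed.

(** The radical of a differential ideal is differential in characteristic zero
    (Ritt): if x^(k+1) (Dx)^m is flat, differentiating it and multiplying by Dx
    shows that x^k (Dx)^(m+2) is flat. *)
Lemma flat_pow u n : flat (u ^+ n) -> flat u.
Proof.
move=> Jun; apply: (flat_max (S := fun x => exists n, flat (x ^+ n))); last by exists n.
  move=> x [k /flat_ev]; rewrite rmorphXn => /eqP.
  by rewrite expf_eq0 => /andP[_ /eqP].
move=> i x [k Jxk]; suff aux : forall k m, flat (x ^+ k * D i x ^+ m) ->
    exists m', flat (D i x ^+ m').
  by apply: (aux k 0%N); rewrite mulr1.
move=> {Jxk} {}k; elim: k => [|k IH] m Jkm; first by exists m; rewrite -[_ ^+ m]mul1r.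
apply: (IH m.+2); apply: (@flat_mulrn k).
have sE : D i (x ^+ k.+1) = x ^+ k * D i x *+ k.+1.
  elim: k {IH Jkm} => [|k IH]; first by rewrite expr1 mul1r.
  by rewrite exprS DM IH mulrS [x ^+ k.+1]exprS; ring.
have -> : x ^+ k * D i x ^+ m.+2 *+ k.+1 =
   D i x * D i (x ^+ k.+1 * D i x ^+ m) -
   (x ^+ k.+1 * D i x ^+ m) * D i (D i x) *+ m.
  rewrite DM mulrDr.
  have -> : D i x * (x ^+ k.+1 * D i (D i x ^+ m)) =
     x ^+ k.+1 * (D i x ^+ m * D i (D i x) *+ m) by rewrite -derX; ring.
  by rewrite sE !exprS; ring.
apply: flatB; first by apply: flatMl; apply: flat_der.
by rewrite -mulrnAr; apply: flatMr.
Qed.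

(** The elements x with u x flat are stable under the derivations: (u Dx)^2 is
    flat, hence so is u Dx by [flat_pow].  If one of them did not vanish at the
    point, then u would be flat by [flat_unit]. *)
Lemma flat_prime u h : flat (u * h) -> ~ flat u -> flat h.
Proof.
move=> Juh Nu; apply: (flat_max (S := fun x => flat (u * x))) => //.
  move=> x Jux; apply/eqP; apply: contraT => x0; case: Nu.
  exact: flat_unit Jux.
move=> i x Jux; apply: (@flat_pow _ 2).
have -> : (u * D i x) ^+ 2 =
    u * D i x * D i (u * x) - (u * x) * (D i u * D i x) by rewrite DM; ring.
by apply: flatB; [apply: flatMl; apply: flat_der|apply: flatMr].
Qed.

(** Differentiating p(t) along a derivation that does not kill t at the point
    lowers the degree until a nonzero constant is left. *)
Lemma flat_horner (iota : {rmorphism C -> A}) (p : {poly C}) i t :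
  (forall c, ev (iota c) = c) -> (forall c, D i (iota c) = 0) ->
  ev (D i t) != 0 -> p != 0 -> ~ flat (map_poly iota p).[t].
Proof.
move=> evi Di Dt; move: {2}(size p) (leqnn (size p)) => n.
elim: n p => [|n IH] p; first by rewrite leqn0 size_poly_eq0 => ->.
move=> sp p0 Jpt.
have chain : D i (map_poly iota p).[t] = (map_poly iota p^`()).[t] * D i t.
  elim/poly_ind: (p) => [|q c IHq].
    by rewrite deriv0 rmorph0 horner0 mul0r -(rmorph0 iota) Di rmorph0.
  rewrite derivMXaddC !rmorphD !rmorphM /= map_polyX map_polyC !hornerE.
  by rewrite DD DM IHq Di; ring.
have [p'0|p'0] := eqVneq p^`() 0.
  have /size1_polyC pc : (size p <= 1)%N.
    apply/leq_sizeP => -[|j] // _; have := congr1 (fun q : {poly C} => q`_j) p'0.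
    by rewrite coef_deriv coef0 => /eqP; rewrite mulrn_eq0 => /eqP.
  move: (flat_ev Jpt) p0; rewrite pc map_polyC hornerC evi => ->.
  by rewrite polyC0 eqxx.
case: (IH p^`()) => //; first by rewrite -ltnS (leq_trans _ sp) // lt_size_deriv.
by apply: flat_unit Dt _; rewrite -chain; apply: flat_der.
Qed.

End DifferentialGerm.

(** * Elimination by a resultant *)

Lemma mpoly_ring_ind (n : nat) (R : comNzRingType) (P : {mpoly R[n]} -> Prop) :
  (forall c, P c%:MP) -> (forall i, P 'X_i) ->
  (forall p q, P p -> P q -> P (p + q)) ->
  (forall p q, P p -> P q -> P (p * q)) ->
  forall p, P p.
Proof.
move=> PC PX PD PM p; rewrite [p]mpolyE.
elim/big_ind: _ => [|p1 p2|m _]; [by rewrite -mpolyC0|exact: PD|].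
rewrite -mul_mpolyC; apply: (PM) => //; rewrite mpolyXE_id.
elim/big_ind: _ => [|p1 p2|i _]; [by rewrite -mpolyC1|exact: PM|].
elim: (m i) => [|k IH]; first by rewrite expr0 -mpolyC1.
by rewrite exprS; apply: PM.
Qed.

Lemma mpoly_hom_eq (n : nat) (R A : comNzRingType)
    (f g : {rmorphism {mpoly R[n]} -> A}) :
  (forall c, f c%:MP = g c%:MP) -> (forall i, f 'X_i = g 'X_i) -> f =1 g.
Proof.
move=> fgC fgX; apply: mpoly_ring_ind => // p q pE qE.
  by rewrite !rmorphD /= pE qE.
by rewrite !rmorphM /= pE qE.
Qed.

HB.lock Definition msub2 (R A : comNzRingType) (f : {rmorphism R -> A})
    (x y : A) (F : {mpoly R[2]}) : A :=
  mmap f (tnth [tuple x; y]) F.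

Section Msub2.
Variables (R A : comNzRingType) (f : {rmorphism R -> A}) (x y : A).

Fact msub2_is_zmod_morphism : zmod_morphism (msub2 f x y).
Proof. by move=> p q; rewrite unlock mmapB. Qed.

Fact msub2_is_monoid_morphism : monoid_morphism (msub2 f x y).
Proof. by split=> [|p q]; rewrite unlock ?rmorph1 ?rmorphM. Qed.

HB.instance Definition _ := GRing.isZmodMorphism.Build {mpoly R[2]} A
  (msub2 f x y) msub2_is_zmod_morphism.
HB.instance Definition _ := GRing.isMonoidMorphism.Build {mpoly R[2]} A
  (msub2 f x y) msub2_is_monoid_morphism.

Lemma msub2C c : msub2 f x y c%:MP = f c.
Proof. by rewrite unlock mmapC. Qed.
Lemma msub2_X0 : msub2 f x y 'X_ord0 = x.
Proof. by rewrite unlock mmapX mmap1U. Qed.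
Lemma msub2_X1 : msub2 f x y 'X_ord_max = y.
Proof. by rewrite unlock mmapX mmap1U. Qed.

Lemma msub2_unique (g : {rmorphism {mpoly R[2]} -> A}) :
  (forall c, g c%:MP = f c) -> g 'X_ord0 = x -> g 'X_ord_max = y ->
  g =1 msub2 f x y.
Proof.
move=> gC g0 g1; apply: mpoly_hom_eq => [c|i]; first by rewrite /= msub2C.
have [->|->] : i = ord0 \/ i = ord_max; last 2 first.
- by rewrite /= msub2_X0.
- by rewrite /= msub2_X1.
by case: i => -[|[|]] // ?; [left|right]; apply: val_inj.
Qed.
End Msub2.

Lemma msub2_eq (R A : comNzRingType) (f g : {rmorphism R -> A}) (x y : A) :
  f =1 g -> msub2 f x y =1 msub2 g x y.
Proof.
move=> fg F; symmetry; apply: (msub2_unique (g := msub2 g x y)) => [c||].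
- by rewrite /= msub2C fg.
- by rewrite /= msub2_X0.
- by rewrite /= msub2_X1.
Qed.

(** The inner variable is x and the outer one y, so that degrees and leading
    coefficients are taken with respect to y. *)
Definition poly2 (R : comNzRingType) : {mpoly R[2]} -> {poly {poly R}} :=
  msub2 (polyC \o polyC) 'X%:P 'X.
HB.instance Definition _ (R : comNzRingType) :=
  GRing.RMorphism.copy (@poly2 R) (msub2 (polyC \o polyC) 'X%:P 'X).

Lemma subst_poly2 (R A : comNzRingType) (f : {rmorphism R -> A}) (x y : A) F :
  subst (subst f x) y (poly2 F) = msub2 f x y F.
Proof.
apply: (msub2_unique (g := subst (subst f x) y \o @poly2 R)) => [c||] /=.
- by rewrite /poly2 msub2C /= substC /= substC.
- by rewrite /poly2 msub2_X0 substC /= substX.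
- by rewrite /poly2 msub2_X1 substX.
Qed.

Definition embed2 (R : comNzRingType) : {poly R} -> {poly {poly {poly R}}} :=
  polyC \o polyC.
HB.instance Definition _ (R : comNzRingType) :=
  GRing.RMorphism.copy (@embed2 R) (polyC \o polyC).

(** F(a,T) - F(b,Y), where b, a, T, Y are the variables of the nested polynomial
    ring from the inside to the outside. *)
Definition coincidence (R : comNzRingType) (F : {mpoly R[2]}) :
    {poly {poly {poly {poly R}}}} :=
  (map_poly (map_poly polyC) (poly2 F))%:P
    - map_poly (@embed2 R) (poly2 F).

Lemma subst_coincidence (R A : comNzRingType) (beta : {rmorphism {poly R} -> A})
    (a t y : A) F :
  subst (subst (subst beta a) t) y (coincidence F) =
  msub2 (beta \o polyC) a t F - msub2 (beta \o polyC) (beta 'X) y F.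
Proof.
rewrite rmorphB /= substC; congr (_ - _).
  pose g := subst (subst beta a) t \o map_poly (map_poly polyC) \o @poly2 R.
  apply: (msub2_unique (g := g)) => [c||]; rewrite /g /= /poly2.
  - by rewrite msub2C /= map_polyC /= map_polyC /= substC /= substC.
  - by rewrite msub2_X0 /= map_polyC /= map_polyX substC /= substX.
  - by rewrite msub2_X1 /= map_polyX substX.
pose h := subst (subst (subst beta a) t) y \o map_poly (@embed2 R) \o @poly2 R.
apply: (msub2_unique (g := h)) => [c||]; rewrite /h /= /poly2.
- by rewrite msub2C /= map_polyC /= substC /= substC /= substC.
- by rewrite msub2_X0 /= map_polyC /= substC /= substC /= substC.
- by rewrite msub2_X1 /= map_polyX substX.
Qed.

(** Its roots in T, over a generic (a,b), are the y-coordinates of the first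
    point of the pairs with x-coordinates a and b on which F and G agree. *)
Definition elimination (R : comNzRingType) (F G : {mpoly R[2]}) :=
  resultant (coincidence F) (coincidence G).

Section Coincidence.
Variables (R : idomainType) (F : {mpoly R[2]}).
Hypothesis F1 : (1 < size (poly2 F))%N.

Let theta_inj : injective (@embed2 R).
Proof. by move=> p q /polyC_inj /polyC_inj. Qed.

Let size_map : size (map_poly (@embed2 R) (poly2 F)) = size (poly2 F).
Proof. by rewrite size_map_inj_poly ?rmorph0. Qed.

Let size_lt : (size (map_poly (map_poly polyC) (poly2 F))%:P <
  size (- map_poly (@embed2 R) (poly2 F))%R)%N.
Proof. by rewrite size_polyN size_map (leq_ltn_trans (size_polyC_leq1 _)). Qed.

Lemma size_coincidence : size (coincidence F) = size (poly2 F).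
Proof. by rewrite /coincidence addrC size_polyDl ?size_lt // size_polyN size_map. Qed.

Lemma lead_coef_coincidence :
  lead_coef (coincidence F) = - (lead_coef (poly2 F))%:P%:P.
Proof.
rewrite /coincidence addrC lead_coefDl ?size_lt // lead_coefN.
by rewrite (lead_coef_map_inj theta_inj) ?rmorph0.
Qed.
End Coincidence.

Lemma elimination_ideal (R : idomainType) (F G : {mpoly R[2]}) :
  (1 < size (poly2 F))%N -> (1 < size (poly2 G))%N ->
  exists u v, (elimination F G)%:P = u * coincidence F + v * coincidence G.
Proof.
move=> F1 G1; have [||[u v] _ E] := @resultant_in_ideal _ (coincidence F) (coincidence G).
- by rewrite size_coincidence.
- by rewrite size_coincidence.
by exists u, v.
Qed.

(** The leading coefficients must survive the specialization: otherwise the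
    resultant also vanishes when a common root escapes to infinity. *)
Lemma resultant_map_eq0 (E : comNzRingType) (C : closedFieldType)
    (phi : {rmorphism {poly E} -> C}) (p q : {poly {poly E}}) :
  phi (lead_coef p) != 0 -> phi (lead_coef q) != 0 ->
  reflect (exists2 y, root (map_poly phi p) y & root (map_poly phi q) y)
    (phi (resultant p q) == 0).
Proof.
move=> p0 q0; rewrite map_resultant // resultant_eq0.
have g0 : gcdp (map_poly phi p) (map_poly phi q) != 0.
  by rewrite gcdp_eq0 negb_and -lead_coef_eq0 lead_coef_map_eq ?p0.
apply: (iffP idP) => [gcd_gt1|[y py qy]].
  have /closed_rootP[y] : size (gcdp (map_poly phi p) (map_poly phi q)) != 1%N.
    by rewrite neq_ltn gcd_gt1 orbT.
  by rewrite root_gcd => /andP[py qy]; exists y.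
by apply: (root_size_gt1 (a := y)); rewrite // root_gcd py.
Qed.

Lemma root_elimination (C : closedFieldType) (F G : {mpoly C[2]}) (a b t : C) :
  (1 < size (poly2 F))%N -> (1 < size (poly2 G))%N ->
  (lead_coef (poly2 F) * lead_coef (poly2 G)).[b] != 0 ->
  reflect (exists y, msub2 idfun a t F = msub2 idfun b y F /\
                     msub2 idfun a t G = msub2 idfun b y G)
    (root (map_poly (eval_at a b) (elimination F G)) t).
Proof.
move=> F1 G1; rewrite hornerM mulf_eq0 negb_or => /andP[Fb Gb].
have rootP H y : reflect (msub2 idfun a t H = msub2 idfun b y H)
    (root (map_poly (subst (eval_at a b) t) (coincidence H)) y).
  have e x z : msub2 (horner_eval b \o polyC) x z H = msub2 idfun x z H.
    by apply: msub2_eq => c; apply: hornerC.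
  rewrite /root -substE subst_coincidence !e subr_eq0 /= /horner_eval hornerX.
  exact: eqP.
have lead_neq0 H : (1 < size (poly2 H))%N -> (lead_coef (poly2 H)).[b] != 0 ->
    subst (eval_at a b) t (lead_coef (coincidence H)) != 0.
  move=> H1 Hb; rewrite lead_coef_coincidence // rmorphN oppr_eq0 /= substC /= substC.
  exact: Hb.
rewrite /root -substE /elimination.
apply: (iffP (resultant_map_eq0 (lead_neq0 F F1 Fb) (lead_neq0 G G1 Gb))).
  case=> y Fy Gy; exists y; split; first exact: elimT (rootP F y) Fy.
  exact: elimT (rootP G y) Gy.
case=> y [Fy Gy]; exists y; first exact: introT (rootP F y) Fy.
exact: introT (rootP G y) Gy.
Qed.

(** * Hamiltonian derivations on pairs of points *)

Lemma mpoly2_ring_ind (R : comNzRingType) (P : {mpoly R[2]} -> Prop) :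
  (forall c, P c%:MP) -> P 'X_ord0 -> P 'X_ord_max ->
  (forall p q, P p -> P q -> P (p + q)) ->
  (forall p q, P p -> P q -> P (p * q)) ->
  forall p, P p.
Proof.
move=> PC P0 P1 PD PM; apply: mpoly_ring_ind => // i.
have [->|->] // : i = ord0 \/ i = ord_max.
by case: i => -[|[|]] // ?; [left|right]; apply: val_inj.
Qed.

Lemma mderivXU n (R : comNzRingType) (i j : 'I_n) :
  ('X_j : {mpoly R[n]})^`M(i) = (j == i)%:R.
Proof.
rewrite mderivX mnm1E; case: eqP => [->|_]; last by rewrite scale0r.
rewrite scale1r (_ : (U_(i) - U_(i))%MM = 0%MM) ?mpolyX0 //.
by apply/mnmP => k; rewrite mnmBE mnm0E subnn.
Qed.

Definition i_x1 : 'I_4 := @Ordinal 4 0 isT.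
Definition i_y1 : 'I_4 := @Ordinal 4 1 isT.
Definition i_x2 : 'I_4 := @Ordinal 4 2 isT.
Definition i_y2 : 'I_4 := @Ordinal 4 3 isT.

HB.lock Definition ev4 (C : numClosedFieldType) (v : (C * C) * (C * C))
    (g : {mpoly C[4]}) : C := eval4 g v.

Section KellerGeometry.
Variable C : numClosedFieldType.
Implicit Types (v : (C * C) * (C * C)) (F G H K : {mpoly C[2]}).
Local Notation Mx1 := ('X_i_x1 : {mpoly C[4]}).
Local Notation My1 := ('X_i_y1 : {mpoly C[4]}).
Local Notation Mx2 := ('X_i_x2 : {mpoly C[4]}).
Local Notation My2 := ('X_i_y2 : {mpoly C[4]}).

Lemma ev4E v (g : {mpoly C[4]}) : ev4 v g = eval4 g v.
Proof. by rewrite unlock. Qed.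

Fact ev4_is_zmod_morphism v : zmod_morphism (ev4 v).
Proof. by move=> p q; rewrite unlock [LHS]mevalB. Qed.
Fact ev4_is_monoid_morphism v : monoid_morphism (ev4 v).
Proof. by split=> [|p q]; rewrite unlock; [exact: meval1|exact: mevalM]. Qed.
HB.instance Definition _ v := GRing.isZmodMorphism.Build {mpoly C[4]} C
  (ev4 v) (ev4_is_zmod_morphism v).
HB.instance Definition _ v := GRing.isMonoidMorphism.Build {mpoly C[4]} C
  (ev4 v) (ev4_is_monoid_morphism v).

Lemma ev4C v c : ev4 v c%:MP = c.
Proof. by rewrite unlock; apply: mevalC. Qed.
Lemma ev4_x1 v : ev4 v Mx1 = v.1.1.
Proof. by rewrite unlock [LHS]mevalXU. Qed.
Lemma ev4_y1 v : ev4 v My1 = v.1.2.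
Proof. by rewrite unlock [LHS]mevalXU. Qed.
Lemma ev4_x2 v : ev4 v Mx2 = v.2.1.
Proof. by rewrite unlock [LHS]mevalXU. Qed.
Lemma ev4_y2 v : ev4 v My2 = v.2.2.
Proof. by rewrite unlock [LHS]mevalXU. Qed.

Definition pull1 : {mpoly C[2]} -> {mpoly C[4]} := msub2 (@mpolyC 4 C) Mx1 My1.
Definition pull2 : {mpoly C[2]} -> {mpoly C[4]} := msub2 (@mpolyC 4 C) Mx2 My2.
HB.instance Definition _ :=
  GRing.RMorphism.copy pull1 (msub2 (@mpolyC 4 C) Mx1 My1).
HB.instance Definition _ :=
  GRing.RMorphism.copy pull2 (msub2 (@mpolyC 4 C) Mx2 My2).

Lemma pull1C c : pull1 c%:MP = c%:MP. Proof. exact: msub2C. Qed.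
Lemma pull1_X0 : pull1 'X_ord0 = Mx1. Proof. exact: msub2_X0. Qed.
Lemma pull1_X1 : pull1 'X_ord_max = My1. Proof. exact: msub2_X1. Qed.
Lemma pull2C c : pull2 c%:MP = c%:MP. Proof. exact: msub2C. Qed.
Lemma pull2_X0 : pull2 'X_ord0 = Mx2. Proof. exact: msub2_X0. Qed.
Lemma pull2_X1 : pull2 'X_ord_max = My2. Proof. exact: msub2_X1. Qed.

Lemma eval2E F (p : C * C) : eval2 F p = msub2 idfun p.1 p.2 F.
Proof. by rewrite unlock. Qed.

Lemma ev4_pull1 v F : ev4 v (pull1 F) = eval2 F v.1.
Proof.
rewrite eval2E; apply: (msub2_unique (g := ev4 v \o pull1)) => [c||] /=.
- by rewrite pull1C ev4C.
- by rewrite pull1_X0 ev4_x1.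
- by rewrite pull1_X1 ev4_y1.
Qed.

Lemma ev4_pull2 v F : ev4 v (pull2 F) = eval2 F v.2.
Proof.
rewrite eval2E; apply: (msub2_unique (g := ev4 v \o pull2)) => [c||] /=.
- by rewrite pull2C ev4C.
- by rewrite pull2_X0 ev4_x2.
- by rewrite pull2_X1 ev4_y2.
Qed.

Lemma noninj_locusP F G v : noninj_locus F G v <->
  [/\ eval2 F v.1 = eval2 F v.2, eval2 G v.1 = eval2 G v.2 & v.1 <> v.2].
Proof.
split=> [[FG ne]|[FE GE ne]]; last by split=> //; rewrite /keller_map FE GE.
by case: FG.
Qed.

Definition dx F := F^`M(ord0).
Definition dy F := F^`M(ord_max).

(** h |-> J(H,h) in the coordinates of either point, the two contributions being
    added.  On a function of one point alone it is the Poisson bracket with H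
    ([hamiltonian_pull1], [hamiltonian_pull2]), so the bracket of F with
    G(p1) - G(p2) is a difference of two equal constants. *)
Definition hamiltonian H (h : {mpoly C[4]}) : {mpoly C[4]} :=
  pull1 (dx H) * h^`M(i_y1) - pull1 (dy H) * h^`M(i_x1)
  + (pull2 (dx H) * h^`M(i_y2) - pull2 (dy H) * h^`M(i_x2)).

Lemma hamiltonianD H : {morph hamiltonian H : h k / h + k}.
Proof.
move=> h k; rewrite /hamiltonian !mderivD.
move: (pull1 _) (pull1 _) (pull2 _) (pull2 _) => a b c d.
by move: h^`M(_) h^`M(_) h^`M(_) h^`M(_) => h0 h1 h2 h3; ring.
Qed.

Lemma hamiltonianM H h k :
  hamiltonian H (h * k) = hamiltonian H h * k + h * hamiltonian H k.
Proof.
rewrite /hamiltonian !mderivM.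
move: (pull1 _) (pull1 _) (pull2 _) (pull2 _) => a b c d.
move: h^`M(_) h^`M(_) h^`M(_) h^`M(_) => h0 h1 h2 h3.
by move: k^`M(_) k^`M(_) k^`M(_) k^`M(_) => k0 k1 k2 k3; ring.
Qed.

Lemma hamiltonianC H c : hamiltonian H c%:MP = 0.
Proof. by rewrite /hamiltonian !mderivC !mulr0 !subr0 addr0. Qed.

Lemma hamiltonian_x1 H : hamiltonian H Mx1 = - pull1 (dy H).
Proof.
rewrite /hamiltonian !mderivXU /=.
by rewrite !mulr0 ?mulr1 ?subr0 ?sub0r ?addr0 ?add0r ?oppr0.
Qed.
Lemma hamiltonian_y1 H : hamiltonian H My1 = pull1 (dx H).
Proof.
rewrite /hamiltonian !mderivXU /=.
by rewrite !mulr0 ?mulr1 ?subr0 ?sub0r ?addr0 ?add0r ?oppr0.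
Qed.
Lemma hamiltonian_x2 H : hamiltonian H Mx2 = - pull2 (dy H).
Proof.
rewrite /hamiltonian !mderivXU /=.
by rewrite !mulr0 ?mulr1 ?subr0 ?sub0r ?addr0 ?add0r ?oppr0.
Qed.
Lemma hamiltonian_y2 H : hamiltonian H My2 = pull2 (dx H).
Proof.
rewrite /hamiltonian !mderivXU /=.
by rewrite !mulr0 ?mulr1 ?subr0 ?sub0r ?addr0 ?add0r ?oppr0.
Qed.

Lemma jacobianE F G : jacobian F G = dx F * dy G - dy F * dx G.
Proof. by []. Qed.

Lemma jacobianC H c : jacobian H c%:MP = 0.
Proof. by rewrite jacobianE /dx /dy !mderivC !mulr0 subrr. Qed.
Lemma jacobian_X0 H : jacobian H 'X_ord0 = - dy H.
Proof. by rewrite jacobianE /dx /dy !mderivXU /= mulr0 mulr1 sub0r. Qed.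
Lemma jacobian_X1 H : jacobian H 'X_ord_max = dx H.
Proof. by rewrite jacobianE /dx /dy !mderivXU /= mulr0 mulr1 subr0. Qed.
Lemma jacobianD H (p q : {mpoly C[2]}) :
  jacobian H (p + q) = jacobian H p + jacobian H q.
Proof.
rewrite !jacobianE /dx /dy !mderivD; move: H^`M(_) H^`M(_) => a b.
by move: p^`M(_) p^`M(_) q^`M(_) q^`M(_) => p0 p1 q0 q1; ring.
Qed.
Lemma jacobianM H (p q : {mpoly C[2]}) :
  jacobian H (p * q) = jacobian H p * q + p * jacobian H q.
Proof.
rewrite !jacobianE /dx /dy !mderivM; move: H^`M(_) H^`M(_) => a b.
by move: p^`M(_) p^`M(_) q^`M(_) q^`M(_) => p0 p1 q0 q1; ring.
Qed.

Lemma hamiltonian_pull1 H K : hamiltonian H (pull1 K) = pull1 (jacobian H K).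
Proof.
elim/mpoly2_ring_ind: K => [c|||p q pE qE|p q pE qE].
- by rewrite jacobianC rmorph0 pull1C hamiltonianC.
- by rewrite jacobian_X0 rmorphN /= pull1_X0 hamiltonian_x1.
- by rewrite jacobian_X1 pull1_X1 hamiltonian_y1.
- by rewrite rmorphD /= hamiltonianD pE qE jacobianD [RHS]rmorphD.
rewrite rmorphM /= hamiltonianM pE qE jacobianM [RHS]rmorphD.
by congr (_ + _); rewrite [RHS]rmorphM.
Qed.

Lemma hamiltonian_pull2 H K : hamiltonian H (pull2 K) = pull2 (jacobian H K).
Proof.
elim/mpoly2_ring_ind: K => [c|||p q pE qE|p q pE qE].
- by rewrite jacobianC rmorph0 pull2C hamiltonianC.
- by rewrite jacobian_X0 rmorphN /= pull2_X0 hamiltonian_x2.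
- by rewrite jacobian_X1 pull2_X1 hamiltonian_y2.
- by rewrite rmorphD /= hamiltonianD pE qE jacobianD [RHS]rmorphD.
rewrite rmorphM /= hamiltonianM pE qE jacobianM [RHS]rmorphD.
by congr (_ + _); rewrite [RHS]rmorphM.
Qed.

End KellerGeometry.

(** * Polynomials flat at a point of the locus *)

(** The hypothesis says p(y1 + s) = p(y2 + s) for all s by the Taylor expansion,
    so p is periodic. *)
Lemma deriv_eq0_of_shift (C : numFieldType) (p : {poly C}) (y1 y2 : C) :
  y1 != y2 -> (forall k, p^`(k).[y1] = p^`(k).[y2]) -> p^`() = 0.
Proof.
move=> y12; move: {2}(size p) (leqnn (size p)) => n.
elim: n p => [|n IH] p sp pk.
  by move: sp; rewrite leqn0 size_poly_eq0 => /eqP ->; rewrite deriv0.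
have [->|p0] := eqVneq p 0; first by rewrite deriv0.
have p''0 : p^`()^`() = 0.
  apply: IH => [|k]; first by rewrite -ltnS (leq_trans _ sp) // lt_size_deriv.
  by rewrite -derivSn pk.
have /size1_polyC p'E : (size p^`() <= 1)%N.
  apply/leq_sizeP => -[|j] // _.
  have /eqP := congr1 (fun q : {poly C} => q`_j) p''0.
  by rewrite coef_deriv coef0 mulrn_eq0 => /eqP.
set al := p^`()`_0 in p'E.
have pE : p = al *: 'X + (p`_0)%:P.
  apply/polyP => -[|j]; rewrite coefD coefZ coefX coefC /= ?mulr0 ?add0r //.
  have /eqP := congr1 (fun q : {poly C} => q`_j) p'E.
  rewrite coef_deriv coefC; case: j => [|j] /=; first by rewrite mulr1n mulr1 addr0 => /eqP.
  by rewrite mulrn_eq0 mulr0 addr0 => /eqP.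
have : al * y1 + p`_0 = al * y2 + p`_0.
  by have := pk 0%N; rewrite !derivn0 {1 2}pE !hornerE.
move/addIr/eqP.
rewrite -subr_eq0 -mulrBr mulf_eq0 subr_eq0 (negbTE y12) orbF => /eqP al0.
by rewrite p'E al0.
Qed.

Lemma subst_comp (R : nzRingType) (A B : comNzRingType)
    (f : {rmorphism R -> A}) (g : {rmorphism A -> B}) (x : A) p :
  g (subst f x p) = subst (g \o f) (g x) p.
Proof. by rewrite !substE -horner_map -map_poly_comp. Qed.

Lemma subst_eq (R : nzRingType) (A : comNzRingType)
    (f g : {rmorphism R -> A}) (x : A) : f =1 g -> subst f x =1 subst g x.
Proof. by move=> fg p; rewrite !substE (eq_map_poly fg). Qed.

Section Fiber.
Variable (C : numClosedFieldType).

Definition restrict_x (a : C) : {mpoly C[2]} -> {poly C} := msub2 polyC a%:P 'X.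
HB.instance Definition _ a := GRing.RMorphism.copy (restrict_x a) (msub2 polyC a%:P 'X).

Lemma restrict_xE a F y : (restrict_x a F).[y] = eval2 F (a, y).
Proof.
rewrite eval2E /=; apply: (msub2_unique (g := horner_eval y \o restrict_x a)) => [c||] /=.
- by rewrite /restrict_x msub2C; apply: hornerC.
- by rewrite /restrict_x msub2_X0; apply: hornerC.
- by rewrite /restrict_x msub2_X1; apply: hornerX.
Qed.

Lemma restrict_x_dy a F : restrict_x a (dy F) = (restrict_x a F)^`().
Proof.
rewrite /dy; elim/mpoly2_ring_ind: F => [c|||p q pE qE|p q pE qE].
- by rewrite mderivC rmorph0 /restrict_x msub2C derivC.
- by rewrite mderivXU /= rmorph0 /restrict_x msub2_X0 derivC.
- by rewrite mderivXU /= rmorph1 /restrict_x msub2_X1 derivX.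
- by rewrite mderivD !rmorphD /= pE qE derivD.
by rewrite mderivM rmorphD !rmorphM /= pE qE derivM.
Qed.

Lemma poly2_dy (F : {mpoly C[2]}) : poly2 (dy F) = (poly2 F)^`().
Proof.
rewrite /dy; elim/mpoly2_ring_ind: F => [c|||p q pE qE|p q pE qE].
- by rewrite mderivC rmorph0 /poly2 msub2C derivC.
- by rewrite mderivXU /= rmorph0 /poly2 msub2_X0 derivC.
- by rewrite mderivXU /= rmorph1 /poly2 msub2_X1 derivX.
- by rewrite mderivD !rmorphD /= pE qE derivD.
by rewrite mderivM rmorphD !rmorphM /= pE qE derivM.
Qed.

Lemma eval2_poly2 (F : {mpoly C[2]}) p :
  eval2 F p = subst (subst idfun p.1) p.2 (poly2 F).
Proof. by rewrite eval2E subst_poly2. Qed.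

(** Used to see that F and G cannot both be free of y. *)
Lemma dy_eq0 (F : {mpoly C[2]}) p : (size (poly2 F) <= 1)%N -> eval2 (dy F) p = 0.
Proof.
move/size1_polyC => FE; rewrite eval2_poly2 poly2_dy FE derivC.
exact: rmorph0.
Qed.

End Fiber.

Section Keller.
Variables (C : numClosedFieldType) (F G : {mpoly C[2]}) (c : C).
Hypotheses (c0 : c != 0) (jac : jacobian F G = c%:MP).
Local Notation Mx1 := ('X_i_x1 : {mpoly C[4]}).
Local Notation My1 := ('X_i_y1 : {mpoly C[4]}).
Local Notation Mx2 := ('X_i_x2 : {mpoly C[4]}).
Local Notation My2 := ('X_i_y2 : {mpoly C[4]}).

Definition keller_der (b : bool) : {mpoly C[4]} -> {mpoly C[4]} :=
  hamiltonian (if b then F else G).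
Definition flat_at (v : (C * C) * (C * C)) := flat (ev4 v) keller_der.

Let derD b : {morph keller_der b : x y / x + y}. Proof. exact: hamiltonianD. Qed.
Let derM b x y : keller_der b (x * y) = keller_der b x * y + x * keller_der b y.
Proof. exact: hamiltonianM. Qed.
Let derC b k : keller_der b k%:MP = 0. Proof. exact: hamiltonianC. Qed.

Lemma jacobian_self (H : {mpoly C[2]}) : jacobian H H = 0.
Proof. by rewrite jacobianE mulrC subrr. Qed.
Lemma jacobian_anti (H K : {mpoly C[2]}) : jacobian H K = - jacobian K H.
Proof. by rewrite !jacobianE opprB [dx H * _]mulrC [dy H * _]mulrC. Qed.

Lemma jac_eval p : eval2 (dx F) p * eval2 (dy G) p - eval2 (dy F) p * eval2 (dx G) p = c.
Proof.
have := congr1 (fun H => eval2 H p) jac; rewrite jacobianE !eval2E.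
by rewrite rmorphB !rmorphM /= msub2C.
Qed.

Lemma dy_neq0 p : eval2 (dy F) p = 0 -> eval2 (dy G) p = 0 -> False.
Proof.
move=> F0 G0; have := jac_eval p; rewrite F0 G0 mulr0 mul0r subrr => c00.
by move: c0; rewrite -c00 eqxx.
Qed.

Lemma flat_difference b v : noninj_locus F G v ->
  flat_at v (pull1 (if b then F else G) - pull2 (if b then F else G)).
Proof.
case/noninj_locusP => FE GE _; apply: flat_intro => [|b'].
  by rewrite rmorphB /= ev4_pull1 ev4_pull2; case: b; rewrite ?FE ?GE subrr.
suff -> : keller_der b' (pull1 (if b then F else G) - pull2 (if b then F else G)) = 0.
  exact: (flat0 _ derD).
rewrite (der_sub derD) /keller_der hamiltonian_pull1 hamiltonian_pull2.
have [d ->] : exists d, jacobian (if b' then F else G) (if b then F else G) = d%:MP.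
  case: b' b => [] []; rewrite ?jacobian_self -?mpolyC0; try by eexists.
    by exists c.
  by exists (- c); rewrite jacobian_anti jac mpolyCN.
by rewrite pull1C pull2C subrr.
Qed.

(** The combination E = (dG/dy)(p1) D_F - (dF/dy)(p1) D_G is c d/dy1 on functions
    of the first point.  If x1 - x2 is flat then, differentiating it by D_F and
    D_G, so are the differences of dF/dy and of dG/dy at the two points, and E is
    also c d/dy2 on functions of the second point, up to flat terms. *)
Lemma flat_at_dy v K :
  flat_at v (Mx1 - Mx2) -> flat_at v (pull1 K - pull2 K) ->
  flat_at v (pull1 (dy K) - pull2 (dy K)).
Proof.
move=> x12 fK.
have fdy b : flat_at v (pull1 (dy (if b then F else G)) - pull2 (dy (if b then F else G))).
  have := flat_der b x12; rewrite (der_sub derD) /keller_der hamiltonian_x1 hamiltonian_x2.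
  by rewrite opprK addrC => /(flatN derD derM); rewrite opprB.
pose FK := jacobian F K; pose GK := jacobian G K.
have f1 : flat_at v (pull1 (dy G) * (pull1 FK - pull2 FK)
                     - pull1 (dy F) * (pull1 GK - pull2 GK)).
  apply: (flatB derD derM); apply: (flatMl derD derM).
    by have := flat_der true fK; rewrite (der_sub derD) /keller_der hamiltonian_pull1 hamiltonian_pull2.
  by have := flat_der false fK; rewrite (der_sub derD) /keller_der hamiltonian_pull1 hamiltonian_pull2.
have f2 : flat_at v ((pull1 (dy G) - pull2 (dy G)) * pull2 FK
                   - (pull1 (dy F) - pull2 (dy F)) * pull2 GK).
  apply: (flatB derD derM); apply: (flatMr derD derM); first exact: (fdy false).
  exact: (fdy true).
have elimE : dy G * FK - dy F * GK = c%:MP * dy K.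
  rewrite -jac /FK /GK !jacobianE.
  move: (dx F) (dx G) (dx K) (dy F) (dy G) (dy K) => a1 a2 a3 b1 b2 b3; ring.
apply: (flat_unit derD derM (h := c%:MP)); first by rewrite /= ev4C.
have := flatD derD f1 f2; congr flat_at.
clearbody FK GK.
have e1 := congr1 (@pull1 C) elimE; have e2 := congr1 (@pull2 C) elimE.
move: e1 e2; rewrite !rmorphB !rmorphM /= pull1C pull2C.
rewrite [(_ - _) * c%:MP]mulrC => e1 e2; rewrite [RHS]mulrBr -e1 -e2.
move: (pull1 (dy G)) (pull2 (dy G)) (pull1 (dy F)) (pull2 (dy F)) (pull1 FK) (pull2 FK) (pull1 GK) (pull2 GK).
by move=> g1 g2 k1 k2 m1 m2 n1 n2; ring.
Qed.

(** By [flat_at_dy] all y-derivatives of F and of G would agree at the points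
    (a,y1) and (a,y2), making F(a,.) and G(a,.) constant, against the Jacobian
    condition. *)
Lemma not_flat_diagonal v : noninj_locus F G v -> ~ flat_at v (Mx1 - Mx2).
Proof.
move=> Vv x12.
have xE : v.1.1 = v.2.1.
  by apply/eqP; have /eqP := flat_ev x12; rewrite rmorphB /= ev4_x1 ev4_x2 subr_eq0.
have yE : v.1.2 != v.2.2.
  case/noninj_locusP: Vv => _ _ ne; apply/eqP => yE; apply: ne.
  by rewrite [v.1]surjective_pairing [v.2]surjective_pairing xE yE.
have dyk b : eval2 (dy (if b then F else G)) v.1 = 0.
  set H := if b then F else G.
  have fk k : flat_at v (pull1 (iter k (@dy C) H) - pull2 (iter k (@dy C) H)).
    by elim: k => [|k IH] /=; [exact: flat_difference|exact: flat_at_dy].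
  have restrict_k k : restrict_x v.1.1 (iter k (@dy C) H) = (restrict_x v.1.1 H)^`(k).
    elim: k => [|k IH]; first by rewrite derivn0.
    by rewrite iterS restrict_x_dy IH -derivnS.
  rewrite [v.1]surjective_pairing -restrict_xE restrict_x_dy.
  rewrite (deriv_eq0_of_shift (y1 := v.1.2) (y2 := v.2.2)) ?horner0 // => k.
  rewrite -restrict_k !restrict_xE {2}xE -!surjective_pairing.
  by apply/eqP; have /eqP := flat_ev (fk k); rewrite rmorphB /= ev4_pull1 ev4_pull2 subr_eq0.
exact: dy_neq0 (dyk true) (dyk false).
Qed.

(** D_F and D_G send x2 to minus the y-derivatives of F and G at the second
    point, which do not both vanish. *)
Lemma not_flat_x2 v (p : {poly C}) : p != 0 ->
  ~ flat_at v (subst (@mpolyC 4 C) Mx2 p).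
Proof.
move=> p0; rewrite substE.
have [b bP] : exists b, ev4 v (keller_der b Mx2) != 0.
  have [F0|F0] := eqVneq (eval2 (dy F) v.2) 0; last first.
    by exists true; rewrite /keller_der hamiltonian_x2 rmorphN /= ev4_pull2 oppr_eq0.
  exists false; rewrite /keller_der hamiltonian_x2 rmorphN /= ev4_pull2 oppr_eq0.
  by apply/eqP; apply: dy_neq0.
apply: (flat_horner derD derM _ _ bP p0) => k; rewrite ?/=.
  exact: ev4C.
exact: derC.
Qed.

End Keller.

(** * The monic equation of the first y-coordinate *)

Definition linear_growth (C : numClosedFieldType) (Z : set ((C * C) * (C * C))) (rho : C) :=
  0 <= rho /\ forall v, Z v -> `|v.1.2| + `|v.2.2| <= rho + `|v.1.1| + `|v.2.1|.

Lemma linear_growth_of_little_o (C : numClosedFieldType) (Z : set ((C * C) * (C * C))) :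
  y_little_o_height Z -> exists rho, linear_growth Z rho.
Proof.
move=> hy; have [|rho rho0 hrho] := hy (2^-1); first by rewrite invr_gt0 ltr0n.
exists rho; split=> [|v Zv]; first exact: ltW.
have hreal : height v \is Num.real by rewrite /height !realD ?normr_real.
have rhoreal : rho \is Num.real by rewrite gtr0_real.
have [le_rho|lt_rho] := real_leP rhoreal hreal.
  have := hrho v Zv le_rho; rewrite ler_pdivlMl ?ltr0n // /height mulr2n mulrDl mul1r => le1.
  rewrite -addrA ler_wpDl ?(ltW rho0) //.
  rewrite -(lerD2r (`|v.1.2| + `|v.2.2|)); apply: le_trans le1 _.
  by rewrite le_eqVlt; apply/orP; left; apply/eqP; ring.
apply: (@le_trans _ _ (height v)).
  rewrite /height -subr_ge0 (_ : _ - _ = `|v.1.1| + `|v.2.1|) ?addr_ge0 //; ring.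
by rewrite -addrA ler_wpDr ?addr_ge0 // ltW.
Qed.

Section Relation.
Variables (C : numClosedFieldType) (F G : {mpoly C[2]}) (c : C) (rho : C).
Hypotheses (c0 : c != 0) (jac : jacobian F G = c%:MP).
Hypotheses (F1 : (1 < size (poly2 F))%N) (G1 : (1 < size (poly2 G))%N).
Hypothesis growth : linear_growth (noninj_locus F G) rho.
Local Notation Mx1 := ('X_i_x1 : {mpoly C[4]}).
Local Notation My1 := ('X_i_y1 : {mpoly C[4]}).
Local Notation Mx2 := ('X_i_x2 : {mpoly C[4]}).
Local Notation My2 := ('X_i_y2 : {mpoly C[4]}).

Local Notation beta := (subst (@mpolyC 4 C) Mx2).
Local Notation psi := (subst (subst beta Mx1) My1).

Let derD b : {morph keller_der F G b : x y / x + y}. Proof. exact: hamiltonianD. Qed.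
Let derM b x y : keller_der F G b (x * y) = keller_der F G b x * y + x * keller_der F G b y.
Proof. exact: hamiltonianM. Qed.

Lemma subst_coincidence_pull H :
  subst psi My2 (coincidence H) = pull1 H - pull2 H.
Proof.
rewrite subst_coincidence; congr (_ - _).
  by apply: msub2_eq => k; apply: substC.
rewrite /= substX.
by apply: msub2_eq => k; apply: substC.
Qed.

Lemma flat_elimination v : noninj_locus F G v -> flat_at F G v (psi (elimination F G)).
Proof.
move=> Vv; have [u [w PE]] := elimination_ideal F1 G1.
have -> : psi (elimination F G) = subst psi My2 u * (pull1 F - pull2 F)
    + subst psi My2 w * (pull1 G - pull2 G).
  rewrite -(subst_coincidence_pull F) -(subst_coincidence_pull G).
  rewrite -[psi _](substC psi My2) PE [LHS]rmorphD.
  by congr (_ + _); exact: rmorphM.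
apply: (flatD derD); apply: (flatMl derD derM).
  exact: (flat_difference jac true Vv).
exact: (flat_difference jac false Vv).
Qed.

Lemma ev4_psi v M :
  ev4 v (psi M) = subst (eval_at v.1.1 v.2.1) v.1.2 M.
Proof.
rewrite subst_comp /= ev4_y1; apply: subst_eq => q.
rewrite /= subst_comp /= ev4_x1; apply: subst_eq => r.
rewrite /= subst_comp /= ev4_x2 substE /horner_eval; congr (_.[_]).
by apply: map_poly_id => k _; rewrite /= ev4C.
Qed.

(** If the monic factor did not vanish at v, the other factor would be flat
    there, hence so would a nonzero polynomial in x2 or x1 - x2. *)
Lemma monic_cofactor_vanishes (k : nat) (d : {poly C}) M v : d != 0 ->
  elimination F G = (d%:P * ('X - 'X%:P) ^+ k)%:P * M ->
  noninj_locus F G v -> subst (eval_at v.1.1 v.2.1) v.1.2 M = 0.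
Proof.
move=> d0 PE Vv; apply/eqP; rewrite -ev4_psi; apply: contraT => M0.
have := flat_elimination Vv; rewrite PE rmorphM /= substC rmorphM rmorphXn rmorphB /=.
rewrite !substC !substX /= substX => fl.
have fl1 := flat_unit derD derM M0 fl.
have := flat_prime derD derM fl1 (not_flat_x2 c0 jac d0).
move/(flat_pow derD derM) => fl2.
by have := not_flat_diagonal c0 jac Vv fl2.
Qed.

Lemma monic_relation : exists M (d : {poly C}), [/\ M \is monic, d != 0,
  forall v, noninj_locus F G v -> subst (eval_at v.1.1 v.2.1) v.1.2 M = 0 &
  forall a b t, a != b -> d.[b] != 0 -> root (map_poly (eval_at a b) M) t ->
  exists y, noninj_locus F G ((a, t), (b, y))].
Proof.
pose d := lead_coef (poly2 F) * lead_coef (poly2 G).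
have d0 : d != 0.
  by rewrite mulf_neq0 // lead_coef_eq0 -size_poly_gt0 (ltn_trans (ltn0Sn 0)).
have rootP a b t : a != b -> d.[b] != 0 ->
    root (map_poly (eval_at a b) (elimination F G)) t ->
    exists y, noninj_locus F G ((a, t), (b, y)).
  move=> ab db /(root_elimination _ _ F1 G1 db)[y [Fy Gy]]; exists y.
  apply/noninj_locusP; split; rewrite ?eval2E //.
  by move=> [/eqP]; rewrite (negbTE ab).
have [rho0 growthP] := growth.
have [|e [k [M [e0 Mm PE]]]] := bounded_roots_monic_factor d0 rho0 (P := elimination F G).
  move=> a b t ab db /(rootP _ _ _ ab db)[y /growthP /=]; apply: le_trans.
  by rewrite lerDl.
exists M, d; split=> // [v Vv|a b t ab db Mt].
  exact: monic_cofactor_vanishes e0 PE Vv.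
apply: rootP => //; rewrite PE rmorphM.
by rewrite rootM Mt orbT.
Qed.

End Relation.

(** * Equations of the locus and finiteness *)

Section PositiveDegree.
Variables (C : numClosedFieldType).
Implicit Types (F G H : {mpoly C[2]}) (v : (C * C) * (C * C)).

Lemma eval2D F G p : eval2 (F + G) p = eval2 F p + eval2 G p.
Proof. by rewrite !eval2E rmorphD. Qed.

Lemma eval2M F G p : eval2 (F * G) p = eval2 F p * eval2 G p.
Proof. by rewrite !eval2E rmorphM. Qed.

Lemma noninj_locus_addl F G : noninj_locus (F + G) G = noninj_locus F G.
Proof.
apply/seteqP; split=> v /noninj_locusP[FE GE ne]; apply/noninj_locusP; split=> //.
  by move: FE; rewrite !eval2D GE => /addIr.
by rewrite !eval2D FE GE.
Qed.

Lemma noninj_locus_addr F G : noninj_locus F (G + F) = noninj_locus F G.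
Proof.
apply/seteqP; split=> v /noninj_locusP[FE GE ne]; apply/noninj_locusP; split=> //.
  by move: GE; rewrite !eval2D FE => /addIr.
by rewrite !eval2D FE GE.
Qed.

(** M is the monic equation of y1 over C[x1,x2]; outside the roots of d and the
    diagonal its roots do lift to the locus. *)
Definition monic_elimination F G M (d : {poly C}) := [/\ M \is monic, d != 0,
  forall v, noninj_locus F G v -> subst (eval_at v.1.1 v.2.1) v.1.2 M = 0 &
  forall a b t, a != b -> d.[b] != 0 -> root (map_poly (eval_at a b) M) t ->
  exists y, noninj_locus F G ((a, t), (b, y))].

(** The resultant needs F and G of positive degree in y.  The Jacobian condition
    gives this for one of them, and adding it to the other changes neither the
    locus nor the Jacobian. *)
Lemma exists_monic_elimination F G (c rho : C) : c != 0 -> jacobian F G = c%:MP ->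
  linear_growth (noninj_locus F G) rho -> exists M d, monic_elimination F G M d.
Proof.
move=> c0 jac gr.
have [F1|F1] := leqP (size (poly2 F)) 1; have [G1|G1] := leqP (size (poly2 G)) 1.
- by have := dy_neq0 c0 jac (dy_eq0 (0, 0) F1) (dy_eq0 (0, 0) G1).
- have FG : (1 < size (poly2 (F + G)%R))%N.
    by rewrite rmorphD /= addrC size_polyDl // (leq_ltn_trans F1).
  rewrite /monic_elimination -noninj_locus_addl in gr *.
  apply: (monic_relation c0 _ FG G1 gr).
  by rewrite jacobian_anti jacobianD jacobian_self addr0 -jacobian_anti.
- have FG : (1 < size (poly2 (G + F)%R))%N.
    by rewrite rmorphD /= addrC size_polyDl // (leq_ltn_trans G1).
  rewrite /monic_elimination -noninj_locus_addr in gr *.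
  apply: (monic_relation c0 _ F1 FG gr).
  by rewrite jacobianD jacobian_self addr0.
exact: (monic_relation c0 jac F1 G1 gr).
Qed.

End PositiveDegree.

Section Zariski.
Variables (C : numClosedFieldType).
Local Notation Mx1 := ('X_i_x1 : {mpoly C[4]}).
Local Notation My1 := ('X_i_y1 : {mpoly C[4]}).
Local Notation Mx2 := ('X_i_x2 : {mpoly C[4]}).
Local Notation My2 := ('X_i_y2 : {mpoly C[4]}).

(** A Hadamard lemma with polynomial coefficients.  The class of H for which it
    holds is a subring, as in the product rule for differences. *)
Lemma difference_quotients (H : {mpoly C[2]}) : exists A B : {mpoly C[4]},
  pull1 H - pull2 H = A * (Mx1 - Mx2) + B * (My1 - My2) /\
  forall q, ev4 (q, q) A = eval2 (dx H) q /\ ev4 (q, q) B = eval2 (dy H) q.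
Proof.
rewrite /dx /dy; elim/mpoly2_ring_ind: H => [k|||p q|p q].
- exists 0, 0; split; first by rewrite pull1C pull2C !mul0r addr0 subrr.
  by move=> q; rewrite !mderivC !eval2E !rmorph0.
- exists 1, 0; split; first by rewrite pull1_X0 pull2_X0 mul1r mul0r addr0.
  by move=> q; rewrite !mderivXU /= !eval2E !rmorph0 !rmorph1.
- exists 0, 1; split; first by rewrite pull1_X1 pull2_X1 mul1r mul0r add0r.
  by move=> q; rewrite !mderivXU /= !eval2E !rmorph0 !rmorph1.
- move=> [A1 [B1 [E1 D1]]] [A2 [B2 [E2 D2]]]; exists (A1 + A2), (B1 + B2); split.
    by rewrite !rmorphD /= opprD addrACA E1 E2 !mulrDl addrACA.
  move=> r; have [D1x D1y] := D1 r; have [D2x D2y] := D2 r.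
  by rewrite !mderivD !rmorphD /= D1x D2x D1y D2y !eval2D.
move=> [A1 [B1 [E1 D1]]] [A2 [B2 [E2 D2]]].
exists (A1 * pull2 q + pull1 p * A2), (B1 * pull2 q + pull1 p * B2); split.
  rewrite !rmorphM /=.
  have -> : pull1 p * pull1 q - pull2 p * pull2 q =
     (pull1 p - pull2 p) * pull2 q + pull1 p * (pull1 q - pull2 q).
    by move: (pull1 p) (pull2 p) (pull1 q) (pull2 q) => a b a' b'; ring.
  rewrite E1 E2; move: (Mx1 - Mx2) (My1 - My2) (pull1 p) (pull2 q) => a b a' b'.
  by ring.
move=> r; have [D1x D1y] := D1 r; have [D2x D2y] := D2 r.
rewrite !mderivM !rmorphD !rmorphM /= D1x D2x D1y D2y !eval2D ev4_pull1 ev4_pull2.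
by rewrite !eval2E !rmorphM.
Qed.

Lemma cramer_eq0 (a b d e x y : C) : a * x + b * y = 0 -> d * x + e * y = 0 ->
  (x != 0) || (y != 0) -> a * e - b * d = 0.
Proof.
move=> E1 E2 /orP[] n0; apply: (mulIf n0); rewrite mul0r.
  have -> : (a * e - b * d) * x = e * (a * x + b * y) - b * (d * x + e * y) by ring.
  by rewrite E1 E2 !mulr0 subrr.
have -> : (a * e - b * d) * y = a * (d * x + e * y) - d * (a * x + b * y) by ring.
by rewrite E1 E2 !mulr0 subrr.
Qed.

(** The third equation is the determinant of the difference quotients of F and
    G: off the diagonal the vector p1 - p2 is in the kernel of the matrix, while
    on the diagonal the determinant is the Jacobian. *)
Lemma noninj_locus_equations (F G : {mpoly C[2]}) (c : C) :
  c != 0 -> jacobian F G = c%:MP -> exists h : {mpoly C[4]},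
  forall v, noninj_locus F G v <->
    [/\ ev4 v (pull1 F - pull2 F) = 0, ev4 v (pull1 G - pull2 G) = 0 & ev4 v h = 0].
Proof.
move=> c0 jac.
have [A1 [B1 [E1 D1]]] := difference_quotients F.
have [A2 [B2 [E2 D2]]] := difference_quotients G.
exists (A1 * B2 - B1 * A2) => v; split=> [Vv|].
  have /noninj_locusP[FE GE ne] := Vv.
  have F0 : ev4 v (pull1 F - pull2 F) = 0 by rewrite rmorphB /= ev4_pull1 ev4_pull2 FE subrr.
  have G0 : ev4 v (pull1 G - pull2 G) = 0 by rewrite rmorphB /= ev4_pull1 ev4_pull2 GE subrr.
  split=> //; move: F0 G0; rewrite E1 E2 !rmorphD !rmorphM /= !rmorphB /=.
  rewrite ev4_x1 ev4_x2 ev4_y1 ev4_y2 => F0 G0.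
  rewrite rmorphN rmorphM; apply: cramer_eq0 F0 G0 _.
  rewrite !subr_eq0 -negb_and; apply/negP => /andP[/eqP xE /eqP yE]; apply: ne.
  by rewrite [v.1]surjective_pairing [v.2]surjective_pairing xE yE.
rewrite !rmorphB /= !ev4_pull1 !ev4_pull2 !rmorphM => -[/eqP F0 /eqP G0 h0].
move: F0 G0; rewrite !subr_eq0 => /eqP F0 /eqP G0.
apply/noninj_locusP; split=> // vE; move: c0; rewrite -(jac_eval jac v.1).
case: v {F0 G0} vE h0 => q q' /= -> h0.
by rewrite -(D1 q').1 -(D1 q').2 -(D2 q').1 -(D2 q').2 h0 eqxx.
Qed.

Lemma zariski_closed_noninj_locus (F G : {mpoly C[2]}) (c : C) :
  c != 0 -> jacobian F G = c%:MP -> zariski_closed (noninj_locus F G).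
Proof.
move=> c0 jac; have [h hP] := noninj_locus_equations c0 jac.
exists [set g | [\/ g = pull1 F - pull2 F, g = pull1 G - pull2 G | g = h]]%classic.
apply/seteqP; split=> v /=.
  by move=> /hP[F0 G0 h0] g [] ->; rewrite -ev4E.
move=> S0; apply/hP; split; rewrite ev4E; apply: S0.
- exact: Or31.
- exact: Or32.
- exact: Or33.
Qed.

End Zariski.

Section Finiteness.
Variables (C : numClosedFieldType) (Z : set ((C * C) * (C * C))).
Variables (N : nat) (r1 r2 : 'I_N -> {mpoly C[2]}).
Implicit Types (v : (C * C) * (C * C)) (phi : (C * C) * (C * C) -> C).
Hypothesis N_gt0 : (0 < N)%N.
Hypothesis rel1 : forall v, Z v ->
  v.1.2 ^+ N = \sum_(k < N) eval2 (r1 k) (pi1 v) * v.1.2 ^+ k.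
Hypothesis rel2 : forall v, Z v ->
  v.2.2 ^+ N = \sum_(k < N) eval2 (r2 k) (pi1 v) * v.2.2 ^+ k.

(** The restriction of phi to Z is a combination of the monomials y1^i y2^j with
    i, j < N, with coefficients pulled back from the plane.  Working with
    functions on Z makes the ideal of Z implicit. *)
Definition spanned phi := exists a : 'I_N * 'I_N -> {mpoly C[2]},
  forall v, Z v -> phi v =
    \sum_ij eval2 (a ij) (pi1 v) * (v.1.2 ^+ ij.1 * v.2.2 ^+ ij.2).

Lemma spanned_ext phi psi : (forall v, Z v -> phi v = psi v) ->
  spanned psi -> spanned phi.
Proof. by move=> E [a aP]; exists a => v Zv; rewrite E // aP. Qed.

Lemma spannedD phi psi : spanned phi -> spanned psi ->
  spanned (fun v => phi v + psi v).
Proof.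
move=> [a aP] [b bP]; exists (fun ij => a ij + b ij) => v Zv.
rewrite aP // bP // -big_split; apply: eq_bigr => ij _ /=.
by rewrite eval2D mulrDl.
Qed.

Lemma spanned0 : spanned (fun=> 0).
Proof.
exists (fun=> 0) => v _; rewrite big1 // => ij _.
by rewrite eval2E rmorph0 mul0r.
Qed.

Lemma spanned_sum (I : finType) (phi : I -> (C * C) * (C * C) -> C) :
  (forall i, spanned (phi i)) -> spanned (fun v => \sum_i phi i v).
Proof.
move=> sp; have : forall s : seq I, spanned (fun v => \sum_(i <- s) phi i v).
  elim=> [|i s IH].
    by apply: spanned_ext spanned0 => v _; rewrite big_nil.
  by apply: spanned_ext (spannedD (sp i) IH) => v _; rewrite big_cons.
by move/(_ (index_enum I)).
Qed.

Lemma spanned_monomial h (i j : 'I_N) :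
  spanned (fun v => eval2 h (pi1 v) * (v.1.2 ^+ i * v.2.2 ^+ j)).
Proof.
exists (fun ij => if ij == (i, j) then h else 0) => v _.
rewrite (bigD1 (i, j)) //= eqxx big1 ?addr0 // => ij /negbTE ->.
by rewrite eval2E rmorph0 mul0r.
Qed.

Lemma spanned_pow1 h (i : nat) (j : 'I_N) : (i <= N)%N ->
  spanned (fun v => eval2 h (pi1 v) * (v.1.2 ^+ i * v.2.2 ^+ j)).
Proof.
rewrite leq_eqVlt => /orP[/eqP -> | iN]; last exact: (spanned_monomial h (Ordinal iN) j).
have := spanned_sum (fun k : 'I_N => spanned_monomial (h * r1 k) k j).
apply: spanned_ext => v Zv; rewrite /= rel1 // [_ * v.2.2 ^+ j]mulr_suml [LHS]mulr_sumr.
by apply: eq_bigr => k _; rewrite eval2M; move: (eval2 _ _) (eval2 _ _) => e e'; ring.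
Qed.

Lemma spanned_pow2 h (i : 'I_N) (j : nat) : (j <= N)%N ->
  spanned (fun v => eval2 h (pi1 v) * (v.1.2 ^+ i * v.2.2 ^+ j)).
Proof.
rewrite leq_eqVlt => /orP[/eqP -> | jN]; last exact: (spanned_monomial h i (Ordinal jN)).
have := spanned_sum (fun k : 'I_N => spanned_monomial (h * r2 k) i k).
apply: spanned_ext => v Zv; rewrite /= rel2 // [v.1.2 ^+ i * _]mulr_sumr [LHS]mulr_sumr.
by apply: eq_bigr => k _; rewrite eval2M; move: (eval2 _ _) (eval2 _ _) => e e'; ring.
Qed.

Lemma spanned_coef h phi : spanned phi -> spanned (fun v => eval2 h (pi1 v) * phi v).
Proof.
move=> [a aP]; exists (fun ij => h * a ij) => v Zv; rewrite /= aP // [LHS]mulr_sumr.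
by apply: eq_bigr => ij _; rewrite mulrA eval2M.
Qed.

Lemma spanned_y1 phi : spanned phi -> spanned (fun v => v.1.2 * phi v).
Proof.
move=> [a aP].
have := spanned_sum (fun ij : 'I_N * 'I_N => spanned_pow1 (a ij) ij.2 (ltn_ord ij.1)).
apply: spanned_ext => v Zv; rewrite /= aP // [LHS]mulr_sumr.
by apply: eq_bigr => ij _; rewrite exprS; move: (eval2 _ _) => e; ring.
Qed.

Lemma spanned_y2 phi : spanned phi -> spanned (fun v => v.2.2 * phi v).
Proof.
move=> [a aP].
have := spanned_sum (fun ij : 'I_N * 'I_N => spanned_pow2 (a ij) ij.1 (ltn_ord ij.2)).
apply: spanned_ext => v Zv; rewrite /= aP // [LHS]mulr_sumr.
by apply: eq_bigr => ij _; rewrite exprS; move: (eval2 _ _) => e; ring.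
Qed.

(** The induction on g needs an arbitrary spanned factor, since spanned
    functions are only seen to be stable under products by coordinates. *)
Lemma spanned_all (g : {mpoly C[4]}) phi : spanned phi ->
  spanned (fun v => ev4 v g * phi v).
Proof.
elim/mpoly_ring_ind: g phi => [k phi sp|i phi sp|p q IHp IHq phi sp|p q IHp IHq phi sp].
- apply: spanned_ext (spanned_coef k%:MP sp) => v _.
  by rewrite ev4C eval2E msub2C.
- have [->|->|->|->] : [\/ i = i_x1, i = i_y1, i = i_x2 | i = i_y2].
  + by case: i => -[|[|[|[|]]]] // ?; [apply: Or41|apply: Or42|apply: Or43|apply: Or44]; apply: val_inj.
  + apply: spanned_ext (spanned_coef 'X_ord0 sp) => v _.
    by rewrite ev4_x1 eval2E msub2_X0.
  + by apply: spanned_ext (spanned_y1 sp) => v _; rewrite ev4_y1.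
  + apply: spanned_ext (spanned_coef 'X_ord_max sp) => v _.
    by rewrite ev4_x2 eval2E msub2_X1.
  + by apply: spanned_ext (spanned_y2 sp) => v _; rewrite ev4_y2.
- by apply: spanned_ext (spannedD (IHp _ sp) (IHq _ sp)) => v _; rewrite rmorphD mulrDl.
by apply: spanned_ext (IHp _ (IHq _ sp)) => v _; rewrite rmorphM mulrA.
Qed.

Lemma finite_of_relations : zariski_closed Z -> finite_morphism Z (@pi1 C).
Proof.
move=> Zc; split=> //; exists ('X_i_x1), ('X_i_x2); split=> [v _|].
  by rewrite -!ev4E ev4_x1 ev4_x2.
pose pair (i : 'I_#|{: 'I_N * 'I_N}|) : 'I_N * 'I_N := enum_val i.
exists #|{: 'I_N * 'I_N}|.
exists (fun i => 'X_i_y1 ^+ (pair i).1 * 'X_i_y2 ^+ (pair i).2) => g.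
have [|a aP] := @spanned_all g (fun=> 1).
  apply: spanned_ext (spanned_monomial 1 (Ordinal N_gt0) (Ordinal N_gt0)) => v _.
  by rewrite eval2E rmorph1 !expr0 !mulr1.
exists (fun i => a (pair i)) => v Zv.
rewrite -ev4E rmorphB /= -[ev4 v g]mulr1 aP // rmorph_sum /=.
apply/eqP; rewrite subr_eq0; apply/eqP.
rewrite (big_enum_val (fun ij => _)) /=; apply: eq_bigr => i _.
rewrite !rmorphM !rmorphXn /= ev4_y1 ev4_y2; congr (_ * _).
rewrite eval2E; symmetry.
pose tu : 2.-tuple {mpoly C[4]} := [tuple 'X_i_x1; 'X_i_x2].
apply: (msub2_unique (g := ev4 v \o comp_mpoly tu)) => [k||] /=.
- by rewrite comp_mpolyC ev4C.
- by rewrite comp_mpolyXU /= ev4_x1.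
- by rewrite comp_mpolyXU /= ev4_x2.
Qed.

End Finiteness.

(** * Topology of the projection *)

Section PowerRelation.
Variable C : numClosedFieldType.

Definition bivariate : {poly {poly C}} -> {mpoly C[2]} :=
  subst (subst (@mpolyC 2 C) 'X_ord_max) 'X_ord0.

Lemma eval2_bivariate q (p : C * C) : eval2 (bivariate q) p = eval_at p.1 p.2 q.
Proof.
rewrite eval2E /bivariate subst_comp /= msub2_X0; apply: subst_eq => r /=.
rewrite subst_comp /= msub2_X1 substE /horner_eval; congr (_.[_]).
by apply: map_poly_id => k _; rewrite /= msub2C.
Qed.

Definition flip (r : {mpoly C[2]}) : {mpoly C[2]} :=
  msub2 (@mpolyC 2 C) 'X_ord_max 'X_ord0 r.

Lemma eval2_flip r (p : C * C) : eval2 (flip r) p = eval2 r (p.2, p.1).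
Proof.
rewrite !eval2E /flip; pose f := msub2 (@mpolyC 2 C) 'X_ord_max 'X_ord0.
apply: (msub2_unique (g := msub2 idfun p.1 p.2 \o f)) => [k||] /=; rewrite /f.
- by rewrite !msub2C.
- by rewrite msub2_X0 msub2_X1.
- by rewrite msub2_X1 msub2_X0.
Qed.

Definition lower_coef (M : {poly {poly {poly C}}}) (k : nat) : {mpoly C[2]} :=
  bivariate (- M`_k).

Lemma monic_top_power M (N : nat) (p : C * C) y : M \is monic -> size M = N.+1 ->
  subst (eval_at p.1 p.2) y M = 0 ->
  y ^+ N = \sum_(k < N) eval2 (lower_coef M k) p * y ^+ k.
Proof.
move=> Mm sM; rewrite substE horner_coef size_map_poly_id0; last first.
  by rewrite (monicP Mm) rmorph1 oner_neq0.
have top1 : (map_poly (eval_at p.1 p.2) M)`_N = 1.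
  rewrite coef_map_id0 ?rmorph0 //; have := monicP Mm.
  by rewrite lead_coefE sM => ->; apply: rmorph1.
rewrite sM big_ord_recr /= top1 mul1r addrC => /eqP; rewrite addr_eq0 => /eqP ->.
rewrite -sumrN; apply: eq_bigr => k _.
rewrite eval2_bivariate -mulNr; congr (_ * _).
by rewrite coef_map_id0 ?rmorph0 // -[RHS]/(eval_at p.1 p.2 (- M`_k)) rmorphN.
Qed.

End PowerRelation.

Definition Cplx (R : realType) : numClosedFieldType := R[i].

Section ComplexModulus.
Variable R : realType.
Local Notation C := (Cplx R).
Implicit Types (z w : C) (x y : R).

Definition embed x : C := x%:C%C.
Definition modulus z : R := complex.Re (`|z| : R[i]).

Lemma embedB x y : embed (x - y) = embed x - embed y.
Proof. exact: rmorphB. Qed.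
Lemma embed_le x y : (embed x <= embed y) = (x <= y).
Proof. exact: lecR. Qed.
Lemma embed_lt x y : (embed x < embed y) = (x < y).
Proof. exact: ltcR. Qed.
Lemma embed_Re z : z \is Num.real -> z = embed (complex.Re (z : R[i])).
Proof. by move=> zr; rewrite /embed RRe_real. Qed.
Lemma modulusE z : `|z| = embed (modulus z).
Proof. by rewrite /modulus -embed_Re // normr_real. Qed.
Lemma norm_embed x : `|embed x| = embed `|x|.
Proof. by rewrite [LHS]normc_def /= expr0n /= addr0 sqrtr_sqr. Qed.
Lemma modulus_ge0 z : 0 <= modulus z.
Proof. by rewrite -embed_le -modulusE normr_ge0. Qed.

Lemma cartesian_form z : exists x y,
  [/\ `|x| <= modulus z, `|y| <= modulus z & z = embed x + 'i * embed y].
Proof.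
exists (complex.Re (z : R[i])), (complex.Im (z : R[i])).
have zE : modulus z = Num.sqrt (complex.Re (z : R[i]) ^+ 2 + complex.Im (z : R[i]) ^+ 2).
  by rewrite /modulus [`|_|]normc_def.
split; last exact: complexE.
  by rewrite zE -sqrtr_sqr ler_wsqrtr // lerDl sqr_ge0.
by rewrite zE -sqrtr_sqr ler_wsqrtr // lerDr sqr_ge0.
Qed.

Lemma continuous_embed : continuous embed.
Proof.
move=> x; apply/cvgrPdist_lt => e e0.
have eE : e = embed (complex.Re (e : R[i])) by rewrite -embed_Re // gtr0_real.
have re0 : 0 < complex.Re (e : R[i]) by rewrite -embed_lt -eE.
near=> t.
rewrite -embedB norm_embed eE embed_lt.
by near: t; apply: cvgr_dist_lt.
Unshelve. all: by end_near. Qed.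

Lemma continuous_modulus : continuous modulus.
Proof.
move=> z; apply/(@cvgrPdist_lt _ _ _ (nbhs z) (nbhs_filter z)) => e e0.
exists (embed e) => [|w /= zw]; first by rewrite /= embed_lt.
rewrite -embed_lt; apply: le_lt_trans zw.
by rewrite -norm_embed embedB -!modulusE ler_dist_dist.
Qed.

Definition box (b : R) : set C :=
  (fun t : R * R => embed t.1 + 'i * embed t.2) @` (`[- b, b] `*` `[- b, b]).

(** Compactness is carried over from the real plane. *)
Lemma compact_box b : compact (box b).
Proof.
apply: continuous_compact; last by apply: compact_setX; apply: segment_compact.
apply: continuous_subspaceT => t; apply: cvgD.
  apply: (cvg_comp _ _ (cvg_fst (F := nbhs t.1) (G := nbhs t.2))).
  exact: continuous_embed.
apply: cvgM; first exact: cvg_cst.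
apply: (cvg_comp _ _ (cvg_snd (F := nbhs t.1) (G := nbhs t.2))).
exact: continuous_embed.
Qed.

Lemma sub_box b z : `|z| <= embed b -> box b z.
Proof.
rewrite modulusE embed_le => zb; have [x [y [xz yz ->]]] := cartesian_form z.
exists (x, y) => //; split; rewrite /= in_itv /= -ler_norml.
  exact: le_trans xz zb.
exact: le_trans yz zb.
Qed.

Lemma compact_pair_bounded (K : set (C * C)) : compact K ->
  exists b : R, forall p, K p -> `|p.1| <= embed b /\ `|p.2| <= embed b.
Proof.
move=> cK; pose n (p : C * C) : R := modulus p.1 + modulus p.2.
have cn : continuous n.
  move=> p; apply: cvgD.
    apply: (cvg_comp _ _ (cvg_fst (F := nbhs p.1) (G := nbhs p.2))).
    exact: continuous_modulus.
  apply: (cvg_comp _ _ (cvg_snd (F := nbhs p.1) (G := nbhs p.2))).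
  exact: continuous_modulus.
have [m [_ mP]] := compact_bounded (continuous_compact (continuous_subspaceT cn) cK).
exists (m + 1) => p Kp.
have := mP (m + 1); rewrite ltrDl ltr01 => /(_ isT (n p)) /= nb.
have np : n p <= m + 1.
  by apply: le_trans (ler_norm _) (nb _); exists p.
by rewrite !modulusE !embed_le; split; apply: le_trans np; rewrite ?lerDl ?lerDr modulus_ge0.
Qed.

End ComplexModulus.

Section Topology.
Variable C : numClosedFieldType.

Lemma continuous_fst (U V : topologicalType) : continuous (@fst U V).
Proof. by case=> x y; apply: (@cvg_fst U V (nbhs x) (nbhs y) (nbhs_filter y)). Qed.

Lemma continuous_snd (U V : topologicalType) : continuous (@snd U V).
Proof. by case=> x y; apply: (@cvg_snd U V (nbhs x) (nbhs y) (nbhs_filter x)). Qed.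

Local Notation x1 := (fun v : (C * C) * (C * C) => v.1.1).
Local Notation y1 := (fun v : (C * C) * (C * C) => v.1.2).
Local Notation x2 := (fun v : (C * C) * (C * C) => v.2.1).
Local Notation y2 := (fun v : (C * C) * (C * C) => v.2.2).

Let cont_x1 : continuous x1.
Proof. by move=> v; exact: (continuous_comp (@continuous_fst _ _ v) (@continuous_fst _ _ v.1)). Qed.
Let cont_y1 : continuous y1.
Proof. by move=> v; exact: (continuous_comp (@continuous_fst _ _ v) (@continuous_snd _ _ v.1)). Qed.
Let cont_x2 : continuous x2.
Proof. by move=> v; exact: (continuous_comp (@continuous_snd _ _ v) (@continuous_fst _ _ v.2)). Qed.
Let cont_y2 : continuous y2.
Proof. by move=> v; exact: (continuous_comp (@continuous_snd _ _ v) (@continuous_snd _ _ v.2)). Qed.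

Lemma continuous_pi1 : continuous (@pi1 C).
Proof.
move=> v.
apply: (@cvg_pair _ _ _ (nbhs v) (nbhs v.1.1) (nbhs v.2.1)); [exact: cont_x1|exact: cont_x2].
Qed.

Lemma continuous_ev4 (g : {mpoly C[4]}) :
  continuous (fun v : (C * C) * (C * C) => ev4 v g).
Proof.
move=> v; elim/mpoly_ring_ind: g => [k|i|p q pc qc|p q pc qc].
- have E u : ev4 u k%:MP = k by rewrite ev4C.
  by rewrite /continuous_at (eq_cvg _ _ E) ev4C; apply: cvg_cst.
- have [->|->|->|->] : [\/ i = i_x1, i = i_y1, i = i_x2 | i = i_y2].
  + by case: i => -[|[|[|[|]]]] // ?;
      [apply: Or41|apply: Or42|apply: Or43|apply: Or44]; apply: val_inj.
  + by rewrite /continuous_at (eq_cvg _ _ (@ev4_x1 C)) ev4_x1; apply: cont_x1.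
  + by rewrite /continuous_at (eq_cvg _ _ (@ev4_y1 C)) ev4_y1; apply: cont_y1.
  + by rewrite /continuous_at (eq_cvg _ _ (@ev4_x2 C)) ev4_x2; apply: cont_x2.
  + by rewrite /continuous_at (eq_cvg _ _ (@ev4_y2 C)) ev4_y2; apply: cont_y2.
- have E u : ev4 u (p + q) = ev4 u p + ev4 u q by rewrite rmorphD.
  by rewrite /continuous_at (eq_cvg _ _ E) E; apply: cvgD.
have E u : ev4 u (p * q) = ev4 u p * ev4 u q by rewrite rmorphM.
by rewrite /continuous_at (eq_cvg _ _ E) E; apply: cvgM.
Qed.

Lemma closed_noninj_locus (F G : {mpoly C[2]}) (c : C) :
  c != 0 -> jacobian F G = c%:MP -> closed (noninj_locus F G).
Proof.
move=> c0 jac; have [h hP] := noninj_locus_equations c0 jac.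
pose Z g := [set v : (C * C) * (C * C) | ev4 v g = 0].
have Zc g : closed (Z g).
  have -> : Z g = (fun v => ev4 v g) @^-1` [set 0] by [].
  apply: preimage_closed; last first.
    by apply: accessible_closed_set1; apply: hausdorff_accessible; apply: norm_hausdorff.
  by move=> v _; apply: continuous_ev4.
have -> : noninj_locus F G = Z (pull1 F - pull2 F) `&` Z (pull1 G - pull2 G) `&` Z h.
  apply/seteqP; split=> v; first by move=> /hP[].
  by move=> [[F0 G0] h0]; apply/hP.
by do 2![apply: closedI => //].
Qed.

End Topology.

Section ProperSurjective.
Variable R : realType.
Local Notation C := (Cplx R).
Variables (F G : {mpoly C[2]}) (c rho : C).
Hypotheses (c0 : c != 0) (jac : jacobian F G = c%:MP).
Hypothesis growth : linear_growth (noninj_locus F G) rho.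

Lemma proper_pi1 : proper_on (noninj_locus F G) (@pi1 C).
Proof.
split; first by apply: continuous_subspaceT; apply: continuous_pi1.
move=> K cK; have [b bP] := compact_pair_bounded cK.
have [rho0 growthP] := growth.
pose b' := complex.Re (rho : R[i]) + b + b.
have b'E : embed b' = rho + embed b + embed b.
  have eD x y : embed (x + y) = embed x + embed y :> C by apply: rmorphD.
  by rewrite /b' !eD -embed_Re // ger0_real.
pose Q := (box b' `*` box b') `*` (box b' `*` box b').
have cQ : compact Q by apply: compact_setX; apply: compact_setX; apply: compact_box.
apply: subclosed_compact cQ _.
  apply: closedI; first exact: closed_noninj_locus c0 jac.
  apply: preimage_closed; first by move=> v _; apply: continuous_pi1.
  by apply: compact_closed => //; apply: norm_hausdorff.
move=> v [Vv /bP /= [x1b x2b]].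
have yb := growthP v Vv; have b0 : 0 <= embed b := le_trans (normr_ge0 _) x1b.
have yb' : `|v.1.2| + `|v.2.2| <= embed b'.
  by rewrite b'E; apply: le_trans yb _; rewrite lerD // lerD.
have xb' z : `|z| <= embed b -> `|z| <= embed b'.
  by move=> zb; rewrite b'E -addrA ler_wpDl // ler_wpDl.
split; split; apply: sub_box; rewrite /=.
- exact: xb'.
- by apply: le_trans yb'; rewrite lerDl.
- exact: xb'.
- by apply: le_trans yb'; rewrite lerDr.
Qed.

(** The image of the part of the locus over a compact neighbourhood of (a,b) is
    compact, hence closed, and contains all generic points of the
    neighbourhood, which are dense. *)
Lemma surjective_pi1 M d : monic_elimination F G M d -> (1 < size M)%N ->
  set_surj (noninj_locus F G) setT (@pi1 C).
Proof.
move=> [Mm d0 MV Mlift] sM [a b] _.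
have generic a' b' : a' != b' -> d.[b'] != 0 ->
    exists2 v, noninj_locus F G v & pi1 v = (a', b').
  move=> ab' db'; have /closed_rootP[t Mt] : size (map_poly (eval_at a' b') M) != 1%N.
    by rewrite size_map_poly_id0 ?neq_ltn ?sM ?orbT // (monicP Mm) rmorph1 oner_neq0.
  have [y Vy] := Mlift _ _ _ ab' db' Mt.
  by exists ((a', t), (b', y)).
pose D (z : C) := box (modulus z + 1).
have Dnear z e : 0 < e < 1 -> D z (z + e).
  move=> /andP[e0 e1]; apply: sub_box; apply: le_trans (ler_normD _ _) _.
  have -> : embed (modulus z + 1) = embed (modulus z) + 1 :> C by apply: rmorphD.
  by rewrite -modulusE lerD2l gtr0_norm // ltW.
have [_ /(_ (D a `*` D b))] := proper_pi1.
move=> /(_ (compact_setX (@compact_box _ _) (@compact_box _ _))).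
set W := noninj_locus F G `&` _ => cW.
have : closed (@pi1 C @` W).
  apply: compact_closed; first exact: norm_hausdorff.
  apply: continuous_compact cW; apply: continuous_subspaceT.
  exact: continuous_pi1.
move=> clW; suff [v [Vv _] vE] : (@pi1 C @` W) (a, b) by exists v.
apply: clW => U [[U1 U2] [/= [e1 e1_gt0 U1e] [e2 e2_gt0 U2e]] UU].
(* e / (1 + e) stands for min e 1, C being only partially ordered. *)
have m_gt0 (e : C) : 0 < e -> 0 < e / (1 + e) < 1.
  move=> e0; rewrite divr_gt0 ?addr_gt0 //= ltr_pdivrMr ?addr_gt0 // mul1r.
  by rewrite ltrDr.
have m_le (e : C) : 0 < e -> e / (1 + e) <= e.
  by move=> e0; rewrite ler_pdivrMr ?addr_gt0 // ler_pMr // lerDl ltW.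
have /andP[m2 m2'] := m_gt0 _ e2_gt0; have /andP[m1 m1'] := m_gt0 _ e1_gt0.
have [s /andP[s0 sm] ds] := nonroot_near b d0 m2.
have X0 : 'X - (b + s)%:P != 0 :> {poly C} by rewrite polyXsubC_eq0.
have [r /andP[r0 rm] dr] := nonroot_near a X0 m1.
rewrite !hornerE subr_eq0 in dr.
have [v Vv vE] := generic _ _ dr ds.
exists (a + r, b + s); split.
  exists v => //; split=> //; case: vE => av bv; split; rewrite /= ?av ?bv.
    by apply: Dnear; rewrite r0; apply: lt_trans rm m1'.
  by apply: Dnear; rewrite s0; apply: lt_trans sm m2'.
apply: UU; split=> /=.
  apply: U1e; rewrite /= opprD addrA subrr sub0r normrN gtr0_norm //.
  exact: lt_le_trans rm (m_le _ e1_gt0).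
apply: U2e; rewrite /= opprD addrA subrr sub0r normrN gtr0_norm //.
exact: lt_le_trans sm (m_le _ e2_gt0).
Qed.

Lemma finite_pi1 M d : monic_elimination F G M d -> (1 < size M)%N ->
  finite_morphism (noninj_locus F G) (@pi1 C).
Proof.
move=> [Mm _ MV _] sM; have sE : size M = (size M).-1.+1 by case: (size M) sM.
have N_gt0 : (0 < (size M).-1)%N by rewrite -ltnS -sE.
pose r (k : 'I_(size M).-1) := lower_coef M k.
have rel1 v : noninj_locus F G v -> v.1.2 ^+ (size M).-1 =
    \sum_(k < (size M).-1) eval2 (r k) (pi1 v) * v.1.2 ^+ k.
  by move=> Vv; apply: (@monic_top_power _ _ _ (pi1 v) _ Mm sE (MV v Vv)).
have rel2 v : noninj_locus F G v -> v.2.2 ^+ (size M).-1 =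
    \sum_(k < (size M).-1) eval2 (flip (r k)) (pi1 v) * v.2.2 ^+ k.
  move=> Vv; have Vv' : noninj_locus F G (v.2, v.1).
    case/noninj_locusP: Vv => FE GE ne; apply/noninj_locusP.
    split; [exact: esym FE|exact: esym GE|by move/esym].
  rewrite (@monic_top_power _ _ _ (v.2.1, v.1.1) _ Mm sE (MV _ Vv')).
  by apply: eq_bigr => k _; rewrite eval2_flip.
apply: (finite_of_relations N_gt0 rel1 rel2).
exact: zariski_closed_noninj_locus c0 jac.
Qed.

End ProperSurjective.

Theorem theorem1p3 (R : realType) (F G : {mpoly R[i][2]})
  (hJ : jacobian_pair F G)
  (hninj : ~ injective (keller_map F G))
  (hy : y_little_o_height (noninj_locus F G)) :
  [/\ proper_on (noninj_locus F G) (@pi1 R[i]),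
      finite_morphism (noninj_locus F G) (@pi1 R[i])
    & set_surj (noninj_locus F G) setT (@pi1 R[i])].
Proof.
have [c c0 jac] := hJ.
have [rho growth] := linear_growth_of_little_o hy.
have [M [d MP]] := exists_monic_elimination c0 jac growth.
have [v Vv] : exists v, noninj_locus F G v.
  apply: contrapT => noV; apply: hninj => p q pq; apply: contrapT => ne.
  by apply: noV; exists (p, q).
have sM : (1 < size M)%N.
  have [Mm _ MV _] := MP; rewrite ltnNge; apply/negP => /size1_polyC M1.
  have M1' : M = 1.
    by rewrite M1; congr _%:P; have := monicP Mm; rewrite {1}M1 lead_coefC.
  have := MV v Vv; rewrite M1' rmorph1 => /eqP.
  by rewrite oner_eq0.
split.
- exact: proper_pi1 c0 jac growth.
- exact: (@finite_pi1 R F G c c0 jac M d MP sM).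
exact: (@surjective_pi1 R F G c rho c0 jac growth M d MP sM).
Qed.
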